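(* Let $\Bbbk$ be a field, let $\{c_i=(a_i,b_i)\}_{i=1}^s\subset\mathbb N^2$ be a convex sequence, and let $I=(m_1,\ldots,m_s)\subset \Bbbk[x,y]$ be the convex ideal whose minimal monomial generators are $m_i=x^{a_i}y^{b_i}$, $1\le i\le s$. Let $\mathcal F(I)=\Bbbk[t_1,\ldots,t_s]/L$ be its fiber cone, presented via $t_i\mapsto \overline{m_i}\in I/(x,y)I$. Then the graded Betti numbers of $\mathcal F(I)$ over the standard graded polynomial ring $\Bbbk[t_1,\ldots,t_s]$ satisfy $$\beta_{0,0}(\mathcal F(I))=1,$$ and for $i\ge 1$, $$\beta_{i,i+1}(\mathcal F(I))=i\binom{s-1}{i+1}, \qquad \beta_{i,j}(\mathcal F(I))=0 \text{ for } j\neq i+1.$$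
   Context: A sequence $\{c_i=(a_i,b_i)\}_{i=1}^s$ in $\mathbb N^2$ with $a_1\le\cdots\le a_s$ is convex if $2c_i\le c_{i-1}+c_{i+1}$ componentwise for each $2\le i\le s-1$. A monomial ideal of $\Bbbk[x,y]$ is convex if it is generated by the monomials $x^{a_i}y^{b_i}$ for a convex sequence. The fiber cone of $I$ is the standard graded ring $\mathcal F(I)=\bigoplus_{i\ge0} I^i/(x,y)I^i$. *)

(* Defs.v *)
From HB Require Import structures.
From mathcomp Require Export all_boot all_order all_algebra.
From mathcomp Require Export mpoly.
From Stdlib Require Import ClassicalEpsilon.

Set Implicit Arguments.
Unset Strict Implicit.
Unset Printing Implicit Defensive.

Import GRing.Theory.
Local Open Scope ring_scope.

Section Ideals.
Variable R : comNzRingType.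

Definition ideal_gen (T : finType) (P : pred T) (g : T -> R) (f : R) : Prop :=
  exists h : T -> R, f = \sum_(i | P i) h i * g i.

Definition ideal_mul (I J : R -> Prop) (f : R) : Prop :=
  exists (n : nat) (u v : 'I_n -> R),
    [/\ forall l, I (u l), forall l, J (v l) & f = \sum_l u l * v l].

Fixpoint ideal_pow (I : R -> Prop) (d : nat) : R -> Prop :=
  if d is d'.+1 then ideal_mul I (ideal_pow I d') else fun _ => True.

Definition minimal_generators (T : finType) (g : T -> R) : Prop :=
  forall i : T, ~ ideal_gen (fun j => j != i) g (g i).

End Ideals.

Definition convex_seq (s : nat) (c : 'I_s -> nat * nat) : Prop :=
  (forall i j : 'I_s, i <= j -> (c i).1 <= (c j).1)%N /\
  (forall i j l : 'I_s, j = i.+1 :> nat -> l = j.+1 :> nat ->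
     (2 * (c j).1 <= (c i).1 + (c l).1)%N /\
     (2 * (c j).2 <= (c i).2 + (c l).2)%N).

Section FiberCone.
Variable k : fieldType.

Definition monomial_xy (c : nat * nat) : {mpoly k[2]} :=
  'X_(ord0 : 'I_2) ^+ c.1 * 'X_(ord_max : 'I_2) ^+ c.2.

Definition ideal_xy : {mpoly k[2]} -> Prop :=
  ideal_gen predT (fun i : 'I_2 => 'X_i).

(* The d-th graded piece I^d of the Rees algebra is carried by the
   coefficient of T^d in k[x,y][T]; fiber_null I is the ideal (x,y)R[IT] whose
   quotient of R[IT] is the fiber cone of I. *)
Definition fiber_null (I : {mpoly k[2]} -> Prop)
    (p : {poly {mpoly k[2]}}) : Prop :=
  forall d : nat, ideal_mul ideal_xy (ideal_pow I d) p`_d.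

(* The k-algebra morphism k[t_1,...,t_s] -> R[IT], t_i |-> m_i T. *)
Definition rees_map (s : nat) (m : 'I_s -> {mpoly k[2]}) :
    {mpoly k[s]} -> {poly {mpoly k[2]}} :=
  mmap (fun a : k => (a%:MP)%:P) (fun i => (m i)%:P * 'X).

(* The kernel L of the presentation k[t_1,...,t_s] -> F(I) of the fiber cone of
   I = (m_1,...,m_s). *)
Definition fiber_cone_ideal (s : nat) (m : 'I_s -> {mpoly k[2]})
    (f : {mpoly k[s]}) : Prop :=
  fiber_null (ideal_gen predT m) (rees_map m f).

End FiberCone.

Section Betti.
Variables (k : fieldType) (n : nat).
Local Notation S := {mpoly k[n]}.

(* A represents (on row vectors) a degree-0 map of graded free modules
   \bigoplus_a S(- du a) -> \bigoplus_b S(- dv b). *)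
Definition graded_mx (p q : nat) (du : 'I_p -> nat) (dv : 'I_q -> nat)
    (A : 'M[S]_(p, q)) : Prop :=
  forall a b (m : 'X_{1..n}), m \in msupp (A a b) -> (mdeg m + dv b = du a)%N.

(* Minimal graded free resolutions of S/L, for L a homogeneous ideal:
     ... -> F_2 -> F_1 -> F_0 -> S/L -> 0,
   F_i = \bigoplus_a S(- res_shift i a).  The augmentation F_0 -> S/L is given
   by a lift res_aug to S of the images of the basis vectors.  Shifts may be
   taken in nat because S/L lives in nonnegative degrees. *)
Record min_graded_free_resolution (L : S -> Prop) : Type := MinRes {
  res_rank : nat -> nat;
  res_shift : forall i, 'I_(res_rank i) -> nat;
  res_aug : 'cV[S]_(res_rank 0);
  res_diff : forall i, 'M[S]_(res_rank i.+1, res_rank i);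
  res_aug_graded : graded_mx (@res_shift 0%N) (fun _ : 'I_1 => 0%N) res_aug;
  res_diff_graded :
    forall i, graded_mx (@res_shift i.+1) (@res_shift i) (res_diff i);
  res_aug_surj :
    forall f : S, exists v : 'rV_(res_rank 0), L (f - (v *m res_aug) 0 0);
  res_aug_exact : forall v : 'rV_(res_rank 0),
    L ((v *m res_aug) 0 0) <-> exists w, v = w *m res_diff 0;
  res_diff_exact : forall i (v : 'rV_(res_rank i.+1)),
    v *m res_diff i = 0 <-> exists w, v = w *m res_diff i.+1;
  (* the image of F_{i+1} lies in (t_1,...,t_n) F_i *)
  res_minimal : forall i a b, (res_diff i a b)@_0%MM = 0
}.

Definition num_generators (L : S -> Prop) (F : min_graded_free_resolution L)
    (i j : nat) : nat := #|[set a | @res_shift L F i a == j]|.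

(* beta_{i,j}(S/L): the number of degree j generators of the i-th module of a
   minimal graded free resolution (which does not depend on the resolution). *)
Definition graded_betti (L : S -> Prop) (i j : nat) : nat :=
  epsilon (inhabits 0%N) (fun b : nat =>
    exists F : min_graded_free_resolution L, num_generators F i j = b).

End Betti.

(* Main.v *)
From mathcomp Require Import zify.
From Stdlib Require Import ClassicalEpsilon FunctionalExtensionality.
Require Import Defs.

(* Give t_i the weight i^2.  By convexity t_a t_b with a+2 <= b is congruent
   modulo L to 0 or to the lighter monomial t_(a+1) t_(b-1), while the monomials
   t_a^p t_(a+1)^q stay linearly independent in the fiber cone, because an edge
   of the convex chain spans a supporting line.  So the initial ideal of L is
   (t_a t_b : a+2 <= b).  This monomial ideal has linear quotients, generated by
   the variables t_l with l < b and l <> a, a+1, hence a linear resolution with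
   generators (a, b, La), La a set of such indices l.  A Schreyer-type
   construction lifts it to a resolution of L with the same generators: each
   syzygy is found by reducing a prescribed leading term.  Being linear that
   resolution is minimal, and minimal resolutions have equally many generators
   in each degree, by the usual homotopy argument.  Counting the generators
   gives sum_b (b-1) C(b-2,i-1) = i C(s-1,i+1). *)

Set Implicit Arguments.
Unset Strict Implicit.
Unset Printing Implicit Defensive.

Import GRing.Theory.

(** * Uniqueness of minimal graded free resolutions *)

Section Homogeneous.
Local Open Scope ring_scope.
Variables (k : fieldType) (n : nat).
Local Notation S := {mpoly k[n]}.

(** [graded_betti] is an [epsilon] over all resolutions, so an actual resolution and uniqueness of
    its numbers of generators are both needed. The lower terms of the differentials depend on where
    the convexity inequalities are equalities, so no closed formula is attempted: only leading terms
    are prescribed. What keeps the construction exact is a set [up] of terms at each level, spanning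
    a complement of the image of the next differential. The squares i^2 serve as weights because
    they are strictly convex. They do not separate all monomials, which is harmless: each prescribed
    leading term strictly outweighs the rest of its vector, and division terminates because weights
    are natural numbers. *)

Lemma mcoeff_pihomog (d : nat) (p : S) m :
  (pihomog mdeg d p)@_m = if mdeg m == d then p@_m else 0.
Proof.
rewrite pihomogE big_mkcond raddf_sum /=.
rewrite [in RHS](mpolyE p) raddf_sum /=.
case: ifP => hm.
  apply: eq_bigr => m' _; case: ifP => [//|hm'].
  rewrite mcoeff0 mcoeffZ mcoeffX; case: eqP => [e|_]; last by rewrite mulr0.
  by rewrite e hm in hm'.
apply: big1 => m' _; case: ifP => hm'; last by rewrite mcoeff0.
rewrite mcoeffZ mcoeffX; case: eqP => [e|_]; last by rewrite mulr0.
by rewrite e hm in hm'.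
Qed.

Lemma pihomogM (d f : nat) (p q : S) : q \is f.-homog ->
  pihomog mdeg (d + f) (p * q) = pihomog mdeg d p * q.
Proof.
move=> hq; rewrite {1}(mpolyE p) mulr_suml raddf_sum /=.
rewrite [in RHS]pihomogE mulr_suml [RHS]big_mkcond; apply: eq_bigr => m _.
rewrite -scalerAl linearZ /=.
have hmq : 'X_[m] * q \is (mdeg m + f).-homog.
  by apply: dhomogM => //; rewrite dhomogX.
case: ifP => [/eqP <-|hm]; first by rewrite pihomog_dE // -scalerAl.
rewrite (pihomog_ne0 _ hmq) ?scaler0 ?mul0r //.
by rewrite eqn_add2r hm.
Qed.

Lemma pihomogM_lt (d f : nat) (p q : S) : q \is f.-homog -> (d < f)%N ->
  pihomog mdeg d (p * q) = 0.
Proof.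
move=> hq lt_df; rewrite (mpolyE p) mulr_suml raddf_sum /=.
apply: big1 => m _; rewrite -scalerAl linearZ /=.
have hmq : 'X_[m] * q \is (mdeg m + f).-homog.
  by apply: dhomogM => //; rewrite dhomogX.
rewrite (pihomog_ne0 _ hmq) ?scaler0 //.
by rewrite gtn_eqF // (leq_trans lt_df) // leq_addl.
Qed.

(** The degree [e] component of S(-sh). Without the test, truncated subtraction would return the
    constant term when [e < sh]. *)
Definition hpart (sh e : nat) (p : S) : S :=
  if (sh <= e)%N then pihomog mdeg (e - sh) p else 0.

Definition hproj (q : nat) (sh : 'I_q -> nat) (e : nat) (v : 'rV[S]_q) :
  'rV[S]_q := \row_b hpart (sh b) e (v 0 b).

Lemma mcoeff_hpart sh e p m :
  (hpart sh e p)@_m = if (mdeg m + sh == e)%N then p@_m else 0.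
Proof.
rewrite /hpart; case: leqP => [le|lt].
  by rewrite mcoeff_pihomog -(eqn_add2r sh (mdeg m)) subnK.
by rewrite mcoeff0 gtn_eqF // (leq_trans lt) // leq_addl.
Qed.

Lemma hpart_sum (I : Type) (r : seq I) (P : pred I) (F : I -> S) sh e :
  hpart sh e (\sum_(i <- r | P i) F i) = \sum_(i <- r | P i) hpart sh e (F i).
Proof.
by rewrite /hpart; case: ifP => _; [rewrite raddf_sum | rewrite big1].
Qed.

Lemma hproj_mulmx (p q : nat) (du : 'I_p -> nat) (dv : 'I_q -> nat)
    (A : 'M[S]_(p, q)) (v : 'rV[S]_p) (e : nat) :
  graded_mx du dv A -> hproj dv e (v *m A) = hproj du e v *m A.
Proof.
move=> gA; apply/rowP => c; rewrite !mxE hpart_sum; apply: eq_bigr => b _.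
rewrite mxE; have [->|nz] := eqVneq (A b c) 0.
  by rewrite !mulr0; apply/mpolyP => m; rewrite mcoeff_hpart mcoeff0 if_same.
have hm := gA b c _ (mlead_supp nz).
have hA : A b c \is (mdeg (mlead (A b c))).-homog.
  apply/dhomogP => m /gA; rewrite -hm => /eqP; rewrite eqn_add2r.
  by move/eqP.
rewrite /hpart -hm; move: (mdeg _) hA => d hA; case: (leqP (dv c) e) => h1.
  case: (leqP (d + dv c) e) => h2.
    have -> : (e - dv c = (e - (d + dv c)) + d)%N.
      by rewrite [(d + _)%N]addnC subnDA subnK // leq_subRL // addnC.
    exact: pihomogM.
  by rewrite mul0r (pihomogM_lt _ hA) // ltn_subLR // addnC.
rewrite leqNgt (leq_trans h1) ?mul0r //; exact: leq_addl.
Qed.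

Lemma graded_mxP (p q : nat) (du : 'I_p -> nat) (dv : 'I_q -> nat)
    (A : 'M[S]_(p, q)) :
  graded_mx du dv A <-> (forall a, hproj dv (du a) (row a A) = row a A).
Proof.
split=> [gA a | hA a b m].
  apply/rowP => b; apply/mpolyP => m; rewrite !mxE mcoeff_hpart.
  case: eqP => // hm; apply/esym/eqP; rewrite mcoeff_eq0.
  by apply/negP => /gA.
have /rowP/(_ b) := hA a; rewrite !mxE => <-.
by rewrite mcoeff_msupp mcoeff_hpart; case: ifP => [/eqP|_]; rewrite ?eqxx.
Qed.

Lemma hproj_id (q : nat) (sh : 'I_q -> nat) e (v : 'rV[S]_q) :
  hproj sh e (hproj sh e v) = hproj sh e v.
Proof.
apply/rowP => b; apply/mpolyP => m; rewrite !mxE !mcoeff_hpart.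
by case: (mdeg m + sh b == e)%N.
Qed.

(** Projecting row [a] of an arbitrary lift to degree [du a] makes it graded, and it remains a lift
    because the projection commutes with [D]. *)
Lemma graded_lift (p q r : nat) (du : 'I_p -> nat) (dv : 'I_q -> nat)
    (dw : 'I_r -> nat) (V : 'M[S]_(p, q)) (D : 'M[S]_(r, q)) :
  graded_mx du dv V -> graded_mx dw dv D ->
  (forall a, exists w, row a V = w *m D) ->
  exists2 W, graded_mx du dw W & V = W *m D.
Proof.
move=> /graded_mxP gV gD ex.
have [w hw] := fin_all_exists ex.
pose W := \matrix_(a < p) hproj dw (du a) (w a).
exists W; first by apply/graded_mxP => a; rewrite rowK hproj_id.
apply/row_matrixP => a; rewrite row_mul rowK -(hproj_mulmx _ _ gD) -hw.
by rewrite gV.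
Qed.

Lemma graded_mulmx (p q r : nat) (du : 'I_p -> nat) (dv : 'I_q -> nat)
    (dw : 'I_r -> nat) (A : 'M[S]_(p, q)) (B : 'M[S]_(q, r)) :
  graded_mx du dv A -> graded_mx dv dw B -> graded_mx du dw (A *m B).
Proof.
move=> /graded_mxP gA gB; apply/graded_mxP => a.
by rewrite row_mul (hproj_mulmx _ _ gB) gA.
Qed.

End Homogeneous.

(** * Comparison maps between two minimal resolutions *)

Section Uniqueness.
Local Open Scope ring_scope.
Variables (k : fieldType) (n : nat).
Local Notation S := {mpoly k[n]}.
Variable L : S -> Prop.
Hypothesis L0 : L 0.
Hypothesis LD : forall f g, L f -> L g -> L (f + g).
Hypothesis LM : forall f g, L f -> L (g * f).
Hypothesis Lh : forall d f, L f -> L (pihomog mdeg d f).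

Local Notation c0 := (map_mx (@mcoeff n k 0%MM)).

Lemma L_sum (I : Type) (r : seq I) (P : pred I) (F : I -> S) :
  (forall i, P i -> L (F i)) -> L (\sum_(i <- r | P i) F i).
Proof. by move=> h; elim/big_ind: _. Qed.

Lemma c0_diff (F : min_graded_free_resolution L) i : c0 (res_diff F i) = 0.
Proof. by apply/matrixP => a b; rewrite !mxE res_minimal. Qed.

Lemma row_exact (F : min_graded_free_resolution L) i p
    (V : 'M[S]_(p, res_rank F i.+1)) : V *m res_diff F i = 0 ->
  exists W, V = W *m res_diff F i.+1.
Proof.
move=> h.
have ex a : exists w, row a V = w *m res_diff F i.+1.
  by apply/res_diff_exact; rewrite -row_mul h row0.
have [w hw] := fin_all_exists ex.
exists (\matrix_a w a); apply/row_matrixP => a; rewrite row_mul rowK; exact: hw.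
Qed.

Lemma diff_diff (F : min_graded_free_resolution L) i :
  res_diff F i.+1 *m res_diff F i = 0.
Proof.
apply/row_matrixP => a; rewrite row_mul row0; apply/res_diff_exact.
by exists (delta_mx 0 a); rewrite rowE.
Qed.

(* The fourth condition follows from the homotopy identity, in which
   f g - 1 - h d is the previous differential times the previous homotopy; it is
   all that the induction needs, and it does not mention degree i - 1. *)
Definition comparison (F G : min_graded_free_resolution L) i : Prop :=
  exists (f : 'M[S]_(res_rank F i, res_rank G i))
         (g : 'M[S]_(res_rank G i, res_rank F i))
         (f' : 'M[S]_(res_rank F i.+1, res_rank G i.+1))
         (g' : 'M[S]_(res_rank G i.+1, res_rank F i.+1))
         (h : 'M[S]_(res_rank F i, res_rank F i.+1)),
   [/\ graded_mx (@res_shift _ _ _ F i) (@res_shift _ _ _ G i) f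
         /\ graded_mx (@res_shift _ _ _ G i) (@res_shift _ _ _ F i) g,
       graded_mx (@res_shift _ _ _ F i.+1) (@res_shift _ _ _ G i.+1) f'
         /\ graded_mx (@res_shift _ _ _ G i.+1) (@res_shift _ _ _ F i.+1) g',
       f' *m res_diff G i = res_diff F i *m f
         /\ g' *m res_diff F i = res_diff G i *m g,
       res_diff F i *m (f *m g - 1%:M - h *m res_diff F i) = 0
     & c0 (f *m g) = 1%:M].

Lemma lift_next (F G : min_graded_free_resolution L) i
    (f : 'M[S]_(res_rank F i, res_rank G i)) :
  graded_mx (@res_shift _ _ _ F i) (@res_shift _ _ _ G i) f ->
  (forall a, exists w, row a (res_diff F i *m f) = w *m res_diff G i) ->
  exists2 f', graded_mx (@res_shift _ _ _ F i.+1) (@res_shift _ _ _ G i.+1) f'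
            & f' *m res_diff G i = res_diff F i *m f.
Proof.
move=> gf ex.
have gV := graded_mulmx (@res_diff_graded _ _ _ F i) gf.
by have [W gW ->] := graded_lift gV (@res_diff_graded _ _ _ G i) ex; exists W.
Qed.

(** Surjectivity of the augmentation of [G] lifts each basis vector of F_0; projecting the lift to
    the right degree preserves the congruence because [L] is homogeneous. *)
Lemma lift_start (F G : min_graded_free_resolution L) :
  exists2 f : 'M[S]_(res_rank F 0, res_rank G 0),
    graded_mx (@res_shift _ _ _ F 0%N) (@res_shift _ _ _ G 0%N) f
  & forall v : 'rV_(res_rank F 0),
      L ((v *m f *m res_aug G) 0 0 - (v *m res_aug F) 0 0).
Proof.
have ex a : exists v : 'rV_(res_rank G 0),
    L (res_aug F a 0 - (v *m res_aug G) 0 0) by exact: res_aug_surj.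
have [w hw] := fin_all_exists ex.
pose f := \matrix_a
  hproj (@res_shift _ _ _ G 0%N) (@res_shift _ _ _ F 0%N a) (w a).
exists f; first by apply/graded_mxP => a; rewrite rowK hproj_id.
have hrow a : L ((f *m res_aug G) a 0 - res_aug F a 0).
  have := Lh (@res_shift _ _ _ F 0%N a) (LM (-1) (hw a)).
  rewrite mulN1r opprB raddfB /=.
  suff [-> ->] : pihomog mdeg (res_shift a) ((w a *m res_aug G) 0 0)
        = (f *m res_aug G) a 0
     /\ pihomog mdeg (res_shift a) (res_aug F a 0) = res_aug F a 0 by [].
  split.
    have := hproj_mulmx (w a) (res_shift a) (@res_aug_graded _ _ _ G).
    move/rowP/(_ 0); rewrite !mxE /hpart leq0n subn0 => ->.
    by apply: eq_bigr => b _; rewrite !mxE.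
  have /graded_mxP/(_ a)/rowP/(_ 0) := @res_aug_graded _ _ _ F.
  by rewrite !mxE /hpart leq0n subn0.
move=> v; rewrite -mulmxA !mxE -sumrB; apply: L_sum => a _.
by rewrite -mulrBr; apply: LM.
Qed.

(** By the fourth condition [d] kills f' g' - 1 - d h, so exactness gives the next homotopy. The
    differentials vanish modulo the variables, whence the last condition. *)
Lemma comparisonP (F G : min_graded_free_resolution L) i : comparison F G i.
Proof.
elim: i => [|i [f [g [f' [g' [h [[gf gg] [gf' gg'] [ef eg] eh hc]]]]]]].
  have [f gf hf] := lift_start F G; have [g gg hg] := lift_start G F.
  have key (F' G' : min_graded_free_resolution L)
      (f0 : 'M[S]_(res_rank F' 0, res_rank G' 0)) :
     (forall v : 'rV_(res_rank F' 0),
      L ((v *m f0 *m res_aug G') 0 0 - (v *m res_aug F') 0 0)) ->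
     forall a, exists w, row a (res_diff F' 0 *m f0) = w *m res_diff G' 0.
    move=> hf0 a; rewrite row_mul; set v := row a _.
    apply/(@res_aug_exact _ _ _ G').
    have hv : L ((v *m res_aug F') 0 0).
      by apply/(@res_aug_exact _ _ _ F'); exists (delta_mx 0 a); rewrite /v rowE.
    by have := LD (hf0 v) hv; rewrite subrK.
  have [f' gf' ef'] := lift_next gf (key _ _ _ hf).
  have [g' gg' eg'] := lift_next gg (key _ _ _ hg).
  have ex a : exists w, row a (f *m g - 1%:M) = w *m res_diff F 0.
    rewrite rowE; set v := delta_mx _ _; apply/(@res_aug_exact _ _ _ F).
    have := LD (hg (v *m f)) (hf v); rewrite addrA subrK.
    by rewrite -mulmxA mulmxBr mulmx1 mulmxBl mulmxA [X in L X -> _]addrC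
      [in X in _ -> L X]mxE [X in _ -> L (_ + X)]mxE addrC !mulmxA.
  have [w hw] := fin_all_exists ex.
  have eh : f *m g - 1%:M = (\matrix_a w a) *m res_diff F 0.
    by apply/row_matrixP => a; rewrite row_mul rowK; exact: hw.
  exists f, g, f', g', (\matrix_a w a); split=> //.
    by rewrite -eh subrr mulmx0.
  have -> : f *m g = (\matrix_a w a) *m res_diff F 0 + 1%:M.
    by rewrite -eh subrK.
  by rewrite map_mxD map_mxM c0_diff mulmx0 add0r map_mx1.
have key (F' G' : min_graded_free_resolution L)
    (u : 'M[S]_(res_rank F' i, res_rank G' i)) u' :
   u' *m res_diff G' i = res_diff F' i *m u ->
   forall a, exists w, row a (res_diff F' i.+1 *m u') = w *m res_diff G' i.+1.
  move=> e a; apply/res_diff_exact; rewrite -row_mul -mulmxA e mulmxA.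
  by rewrite diff_diff mul0mx row0.
have [f2 gf2 ef2] := lift_next gf' (key _ _ _ _ ef).
have [g2 gg2 eg2] := lift_next gg' (key _ _ _ _ eg).
have [h' hh'] : exists h', f' *m g' - 1%:M - res_diff F i *m h
    = h' *m res_diff F i.+1.
  apply: row_exact; rewrite -[RHS]eh !mulmxBl !mulmxBr mul1mx mulmx1.
  by rewrite -mulmxA eg !mulmxA ef.
have e1 : f' *m g' - 1%:M = h' *m res_diff F i.+1 + res_diff F i *m h.
  by rewrite -hh' subrK.
exists f', g', f2, g2, h'; split=> //.
  by rewrite e1 [X in X - _]addrC addrK mulmxA diff_diff mul0mx.
have -> : f' *m g' = h' *m res_diff F i.+1 + res_diff F i *m h + 1%:M.
  by rewrite -e1 subrK.
by rewrite !map_mxD !map_mxM !c0_diff mulmx0 mul0mx !add0r map_mx1.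
Qed.

Lemma num_generators_le (F G : min_graded_free_resolution L) i j :
  (num_generators F i j <= num_generators G i j)%N.
Proof.
have [f [g [_ [_ [_ [[gf gg] _ _ _ hc]]]]]] := comparisonP F G i.
rewrite /num_generators.
set A := [set a | _]; set B := [set a | _].
(* Both maps preserve degrees modulo the variables, so their degree j blocks
   are still inverse on one side. *)
apply: (@mulmx1_min k _ _ (\matrix_(x, y) (c0 f) (enum_val x) (enum_val y))
   (\matrix_(x, y) (c0 g) (enum_val x) (enum_val y))).
apply/matrixP => x y; rewrite !mxE.
have := congr1 (fun M : 'M_(_) => M (enum_val x) (enum_val y)) hc.
rewrite map_mxM mxE.
rewrite [X in _ = X]mxE (inj_eq enum_val_inj) => <-.
under eq_bigr => z _ do rewrite [X in X * _]mxE [X in _ * X]mxE.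
rewrite -[LHS](big_enum_val
  (fun z => c0 f (enum_val x) z * c0 g z (enum_val y))).
rewrite [RHS](bigID (fun z => z \in B)) /= [X in _ = _ + X]big1 ?addr0 //.
move=> b hb; rewrite mxE.
have [->|nz] := eqVneq (f (enum_val x) b)@_0%MM 0; first by rewrite mul0r.
have := gf (enum_val x) b 0%MM; rewrite mcoeff_msupp nz => /(_ isT).
rewrite mdeg0 add0n => e; move: hb; rewrite !inE e.
by have := enum_valP x; rewrite !inE => ->.
Qed.

Lemma num_generators_unique (F G : min_graded_free_resolution L) i j :
  num_generators F i j = num_generators G i j.
Proof. by apply/eqP; rewrite eqn_leq !num_generators_le. Qed.

(** [F] shows that the predicate under [epsilon] is inhabited, and uniqueness makes the arbitrary
    choice irrelevant. *)
Lemma graded_bettiE (F : min_graded_free_resolution L) i j :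
  graded_betti L i j = num_generators F i j.
Proof.
rewrite /graded_betti.
have ex : exists b, exists F : min_graded_free_resolution L,
    num_generators F i j = b by exists (num_generators F i j), F.
have [G hG] := epsilon_spec (inhabits 0%N) _ ex.
rewrite -hG; exact: num_generators_unique.
Qed.

End Uniqueness.

(** * Resolutions with prescribed leading terms *)

Section Terms.
Local Open Scope ring_scope.
Variables (k : fieldType) (n : nat).
Local Notation S := {mpoly k[n]}.
Local Notation term q := ('X_{1..n} * 'I_q)%type.

Definition tcoeff q (v : 'rV[S]_q) (x : term q) : k := (v 0 x.2)@_x.1.

Definition term_vec q (x : term q) : 'rV[S]_q := 'X_[x.1] *: delta_mx 0 x.2.

Definition supported q (P : term q -> Prop) (v : 'rV[S]_q) : Prop :=
  forall x, tcoeff v x != 0 -> P x.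

(** [om] is only a weight and may tie on distinct terms. A leading term is monic and must beat all
    others strictly, so a vector need not have one. *)
Definition lead_term q (om : term q -> nat) (v : 'rV[S]_q) (x : term q) : Prop :=
  tcoeff v x = 1 /\ supported (fun y => y = x \/ (om y < om x)%N) v.

Lemma tcoeffD q (u v : 'rV[S]_q) x : tcoeff (u + v) x = tcoeff u x + tcoeff v x.
Proof. by rewrite /tcoeff mxE mcoeffD. Qed.

Lemma tcoeffB q (u v : 'rV[S]_q) x : tcoeff (u - v) x = tcoeff u x - tcoeff v x.
Proof. by rewrite /tcoeff !mxE mcoeffB. Qed.

Lemma tcoeffZ q c (v : 'rV[S]_q) x : tcoeff (c%:MP *: v) x = c * tcoeff v x.
Proof. by rewrite /tcoeff mxE mcoeffCM. Qed.

Lemma tcoeff0 q x : tcoeff (0 : 'rV[S]_q) x = 0.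
Proof. by rewrite /tcoeff mxE mcoeff0. Qed.

Lemma tcoeff_term q (x y : term q) : tcoeff (term_vec x) y = (x == y)%:R.
Proof.
rewrite /tcoeff !mxE eqxx /= eq_sym -pair_eqE /pair_eq /=.
case: (x.2 == y.2); last by rewrite mulr0 mcoeff0 andbF.
by rewrite mulr1 mcoeffX andbT.
Qed.

Lemma tcoeff_eq0 q (v : 'rV[S]_q) : (forall x, tcoeff v x = 0) -> v = 0.
Proof.
move=> h; apply/rowP => b; apply/mpolyP => m; rewrite mxE mcoeff0.
exact: (h (m, b)).
Qed.

Lemma row_terms q (v : 'rV[S]_q) :
  v = \sum_b \sum_(m <- msupp (v 0 b)) (tcoeff v (m, b))%:MP *: term_vec (m, b).
Proof.
rewrite {1}(row_sum_delta v); apply: eq_bigr => b _.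
rewrite {1}(mpolyE (v 0 b)) scaler_suml; apply: eq_bigr => m _.
by rewrite /term_vec scalerA mul_mpolyC.
Qed.

Lemma row_ind q (P : 'rV[S]_q -> Prop) (v : 'rV[S]_q) :
  P 0 -> (forall u w, P u -> P w -> P (u + w)) ->
  (forall c u, P u -> P (c%:MP *: u)) -> supported (P \o @term_vec q) v -> P v.
Proof.
move=> P0 PD PZ h; rewrite (row_terms v).
elim/big_ind: _ => // b _; rewrite big_seq; elim/big_ind: _ => // m hm.
by apply/PZ/h; rewrite /tcoeff -mcoeff_msupp.
Qed.

Lemma tcoeff_bound q (f : term q -> nat) (v : 'rV[S]_q) :
  exists c, supported (fun x => (f x < c)%N) v.
Proof.
exists (\max_(b < q) \max_(m <- msupp (v 0%R b)) f (m, b)).+1 => -[m b] h.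
rewrite ltnS; apply: leq_trans (leq_bigmax b).
by apply: (leq_bigmax_seq (F := fun m => f (m, b))) => //; rewrite mcoeff_msupp.
Qed.

Lemma tcoeff_scaleX q m (v : 'rV[S]_q) x :
  tcoeff ('X_[m] *: v) ((m + x.1)%MM, x.2) = tcoeff v x.
Proof. by rewrite /tcoeff mxE mulrC mcoeffMX. Qed.

Lemma supported_scaleX q m (v : 'rV[S]_q) y : tcoeff ('X_[m] *: v) y != 0 ->
  exists2 x, y = ((m + x.1)%MM, x.2) & tcoeff v x != 0.
Proof.
case: y => y b; rewrite /tcoeff mxE /= mulrC -mcoeff_msupp.
rewrite (perm_mem (msuppMX _ _)) => /mapP[y' hy' ->].
by exists (y', b) => //; rewrite /= -mcoeff_msupp.
Qed.

Lemma lead_term_sub q om (u v : 'rV[S]_q) x :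
  lead_term om u x -> lead_term om v x ->
  supported (fun y => (om y < om x)%N) (u - v).
Proof.
move=> [u1 hu] [v1 hv] y; rewrite tcoeffB => nz.
have [e|ne] := eqVneq y x; first by move: nz; rewrite e u1 v1 subrr eqxx.
have [u0|/hu[e|//]] := eqVneq (tcoeff u y) 0; last by rewrite e eqxx in ne.
by move: nz; rewrite u0 sub0r oppr_eq0 => /hv[e|//]; rewrite e eqxx in ne.
Qed.

End Terms.

(** * Division by prescribed leading terms and Schreyer syzygies *)

Section FrameStep.
Local Open Scope ring_scope.
Variables (k : fieldType) (n : nat).
Local Notation S := {mpoly k[n]}.
Local Notation term q := ('X_{1..n} * 'I_q)%type.

Definition shift_term q p (lead : 'I_p -> term q) (x : term p) : term q :=
  ((x.1 + (lead x.2).1)%MM, (lead x.2).2).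

(* The row a of D has leading term lead a.  The terms outside up are exactly the
   leading terms of the row space of D, and x |-> shift_term lead x matches them
   bijectively with the terms in up'. *)
Variables (q p : nat) (lead : 'I_p -> term q) (D : 'M[S]_(p, q)).
Variables (om : term q -> nat) (up : pred (term q)) (up' : pred (term p)).
Local Notation phi := (shift_term lead).

Hypothesis om_mul : forall m x y, (om x < om y)%N ->
  (om ((m + x.1)%MM, x.2) < om ((m + y.1)%MM, y.2))%N.
Hypothesis D_lead : forall a, lead_term om (row a D) (lead a).
Hypothesis up_inj : forall x y, up' x -> up' y -> phi x = phi y -> x = y.
Hypothesis not_up : forall y, ~~ up y -> exists2 x, up' x & y = phi x.

Lemma term_vec_mul (x : term p) : lead_term om (term_vec k x *m D) (phi x).
Proof.
have -> : term_vec k x *m D = 'X_[x.1] *: row x.2 D.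
  by rewrite -scalemxAl rowE.
have [h1 h2] := D_lead x.2; split.
  by rewrite (tcoeff_scaleX x.1 _ (lead x.2)).
move=> y /supported_scaleX[z -> /h2[->|lt]]; [by left | right].
exact: om_mul.
Qed.

(** A term outside [up] is [phi x] with [x] in [up']; subtracting the multiple of a row with that
    leading term leaves lighter terms only. The weight bound on the quotient [w] later identifies
    the leading terms of syzygies. *)
Lemma normal_form c (v : 'rV[S]_q) : supported (fun y => (om y < c)%N) v ->
  exists w r, [/\ v = w *m D + r, supported up r
    & supported (fun x => up' x /\ (om (phi x) < c)%N) w].
Proof.
pose nf c (v : 'rV[S]_q) := exists w r, [/\ v = w *m D + r, supported up r
    & supported (fun x => up' x /\ (om (phi x) < c)%N) w].
have nf0 d : nf d 0.
  by exists 0, 0; split; rewrite ?mul0mx ?addr0 // => x; rewrite tcoeff0 eqxx.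
have supD q' (P : term q' -> Prop) u v' :
    supported (k := k) P u -> supported P v' -> supported P (u + v').
  move=> hu hv x; rewrite tcoeffD; have [u0|/hu //] := eqVneq (tcoeff u x) 0.
  by rewrite u0 add0r => /hv.
have supZ q' (P : term q' -> Prop) a u :
    supported (k := k) P u -> supported P (a%:MP *: u).
  by move=> hu x; rewrite tcoeffZ mulf_eq0 negb_or => /andP[_ /hu].
have nfD d u v' : nf d u -> nf d v' -> nf d (u + v').
  move=> [w1 [r1 [-> hr1 hw1]]] [w2 [r2 [-> hr2 hw2]]].
  exists (w1 + w2), (r1 + r2); split; [|exact: supD..].
  by rewrite mulmxDl addrACA.
have nfZ d a u : nf d u -> nf d (a%:MP *: u).
  move=> [w [r [-> hr hw]]]; exists (a%:MP *: w), (a%:MP *: r).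
  by split; [rewrite scalerDr scalemxAl | exact: supZ..].
suff nfT d y : (om y < d)%N -> nf d (term_vec k y).
  by move=> h; apply: (@row_ind k n q (nf c)) => // [u w|a u|y /h];
    [exact: nfD|exact: nfZ|exact: nfT].
elim: d y => // d IHd y lt_y.
have [upy|/not_up[x upx ey]] := boolP (up y).
  exists 0, (term_vec k y); split; first by rewrite mul0mx add0r.
    by move=> z; rewrite tcoeff_term; have [<-|] := eqVneq y z; rewrite ?eqxx.
  by move=> z; rewrite tcoeff0 eqxx.
have [h1 h2] := term_vec_mul x.
have : nf d (term_vec k y - term_vec k x *m D).
  apply: (@row_ind k n q (nf d)) => // [u w|a u|z]; [exact: nfD|exact: nfZ|].
  rewrite tcoeffB tcoeff_term => nz; apply: IHd.
  have [ez|nez] := eqVneq y z.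
    by move: nz; rewrite ez eqxx -ez ey h1 subrr eqxx.
  move: nz; rewrite (negbTE nez) sub0r oppr_eq0 => /h2[ez|].
    by rewrite ez -ey eqxx in nez.
  by rewrite -ey => lt; apply: leq_trans lt _.
case=> w [r [e hr hw]]; exists (w + term_vec k x), r; split=> //.
  by rewrite mulmxDl addrAC -e subrK.
apply: supD => z.
  by case/hw => ? lt; split=> //; apply: leq_trans lt _.
by rewrite tcoeff_term; have [<- _|] := eqVneq x z; rewrite ?eqxx // -ey.
Qed.

(** As [phi] is injective on [up'], the leading image of a term [x] of [w] with heaviest [phi x]
    cannot be cancelled in [w *m D]. *)
Lemma lead_free (w : 'rV[S]_p) : supported up' w -> w *m D = 0 -> w = 0.
Proof.
move=> upw; have [c hc] := tcoeff_bound (om \o phi) w.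
elim: c hc => [|c IHc] hc wD.
  by apply: tcoeff_eq0 => x; apply: contraTeq isT => /hc.
apply: IHc => // x nzx; have := hc x nzx; rewrite /= ltnS leq_eqVlt.
case/orP => // /eqP ex.
suff : tcoeff (w *m D) (phi x) = tcoeff w x.
  by rewrite wD tcoeff0 => e0; rewrite -e0 eqxx in nzx.
have [h1 h2] := term_vec_mul x.
pose u := w - (tcoeff w x)%:MP *: term_vec k x.
suff : tcoeff (u *m D) (phi x) = 0.
  rewrite mulmxBl -scalemxAl tcoeffB tcoeffZ h1 mulr1 => /eqP.
  by rewrite subr_eq0 => /eqP.
(* Another term x' of [w] misses [phi x]: its leading image differs, and its lower terms are lighter
   than the maximal weight, that of [phi x]. *)
apply: (@row_ind _ _ _ (fun u => tcoeff (u *m D) (phi x) = 0)).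
- by rewrite mul0mx tcoeff0.
- by move=> u1 u2 e1 e2; rewrite mulmxDl tcoeffD e1 e2 addr0.
- by move=> a u1 e1; rewrite -scalemxAl tcoeffZ e1 mulr0.
move=> x' /=; rewrite tcoeffB tcoeffZ tcoeff_term => nz.
have [exx|ne] := eqVneq x x'.
  by move: nz; rewrite -exx eqxx mulr1 subrr eqxx.
move: nz; rewrite (negbTE ne) mulr0 subr0 => nz.
have [_ h2'] := term_vec_mul x'.
apply/eqP; apply: contraTT isT => /h2'[/up_inj e|].
  by rewrite e ?eqxx // in ne; apply: upw.
by rewrite ex ltnNge -ltnS; have /= -> := hc x' nz.
Qed.

Variables (r : nat) (lead' : 'I_r -> term p) (om' : term p -> nat).
Variables (sh : 'I_q -> nat) (sh' : 'I_p -> nat) (sh'' : 'I_r -> nat).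
Hypothesis up_free : forall u, supported up u -> (exists w, u = w *m D) -> u = 0.
Hypothesis D_graded : graded_mx sh' sh D.
Hypothesis lead_not_up : forall x, ~~ up (phi x).
Hypothesis lead'_not_up : forall a, ~~ up' (lead' a).
Hypothesis om_phi : forall x y, (om (phi x) < om (phi y))%N -> (om' x < om' y)%N.
Hypothesis om_tie : forall x y, up' x -> phi x = phi y -> x = y \/ (om' x < om' y)%N.
Hypothesis lead'_deg : forall a, sh'' a = (mdeg (lead' a).1 + sh' (lead' a).2)%N.

(** Schreyer's construction: [y = lead' a] and the term [x] of [up'] matched with [phi y] have the
    same leading image. Dividing the difference of their images by [D] leaves remainder 0, by
    [up_free]. *)
Lemma frame_syzygy (a : 'I_r) : exists kappa : 'rV[S]_p,
  [/\ kappa *m D = 0, hproj sh' (sh'' a) kappa = kappa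
    & lead_term om' kappa (lead' a)].
Proof.
have [y ey] : exists y, y = lead' a by exists (lead' a).
have upy : ~~ up' y by rewrite ey.
have [x upx exy] := not_up (lead_not_up y).
have nxy : (x == y) = false by apply: contraNF upy => /eqP <-.
have hx : lead_term om (term_vec k x *m D) (phi y).
  by rewrite exy; apply: term_vec_mul.
have hy := term_vec_mul y.
have [w [u [e upu hw]]] : exists w u, [/\
    (term_vec k y - term_vec k x) *m D = w *m D + u, supported up u
    & supported (fun z => up' z /\ (om (phi z) < om (phi y))%N) w].
  apply: normal_form; rewrite mulmxBl.
  exact: lead_term_sub hy hx.
have u0 : u = 0.
  apply: up_free => //; exists (term_vec k y - term_vec k x - w).
  by rewrite mulmxBl e addrC addKr.
pose v := term_vec k y - term_vec k x - w.
have vD : v *m D = 0 by rewrite mulmxBl e u0 addr0 subrr.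
exists (hproj sh' (sh'' a) v); split; rewrite ?hproj_id // -?ey.
  by rewrite -(hproj_mulmx _ _ D_graded) vD; apply: tcoeff_eq0 => z;
    rewrite /tcoeff !mxE mcoeff_hpart mcoeff0 if_same.
have hpr z : tcoeff (hproj sh' (sh'' a) v) z =
    if (mdeg z.1 + sh' z.2 == sh'' a)%N then tcoeff v z else 0.
  by rewrite /tcoeff mxE mcoeff_hpart.
have hv z : tcoeff v z = (y == z)%:R - (x == z)%:R - tcoeff w z.
  by rewrite !tcoeffB !tcoeff_term.
(* [y] keeps coefficient 1, since [x] and the terms of [w] lie in [up']. It outweighs [x] by the
   tie-break, and the terms of [w] because their leading images are lighter. *)
split.
  rewrite hpr lead'_deg -ey eqxx hv eqxx nxy subr0.
  have [->|/hw[]] := eqVneq (tcoeff w y) 0; first by rewrite subr0.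
  by rewrite (negbTE upy).
move=> z; rewrite hpr; case: ifP => _; last by rewrite eqxx.
rewrite hv; have [->|ne] := eqVneq y z; first by left.
have [<- _|ne'] := eqVneq x z.
  by right; case: (om_tie upx (esym exy)) => // e0; rewrite e0 eqxx in nxy.
rewrite !sub0r oppr0 add0r oppr_eq0 => /hw[_ lt]; right; exact: om_phi.
Qed.

End FrameStep.

(** * Assembling a resolution from its leading terms *)

Section Frame.
Local Open Scope ring_scope.
Variables (k : fieldType) (n : nat).
Local Notation S := {mpoly k[n]}.
Local Notation term q := ('X_{1..n} * 'I_q)%type.

Variables (L : S -> Prop) (r : nat -> nat).
Variables (lead : forall i, 'I_(r i.+1) -> term (r i)).
Variables (om : forall i, term (r i) -> nat) (up : forall i, pred (term (r i))).
Variable sh : forall i, 'I_(r i) -> nat.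

Local Notation phi := (fun i => shift_term (@lead i)).

Hypothesis L0 : L 0.
Hypothesis LD : forall f g, L f -> L g -> L (f + g).
Hypothesis LM : forall f g, L f -> L (g * f).
Hypothesis om_mul : forall i m (x y : term (r i)), (om x < om y)%N ->
  (om ((m + x.1)%MM, x.2) < om ((m + y.1)%MM, y.2))%N.
Hypothesis om_phi : forall i (x y : term (r i.+1)),
  (om (phi i x) < om (phi i y))%N -> (om x < om y)%N.
Hypothesis om_tie : forall i (x y : term (r i.+1)),
  up x -> phi i x = phi i y -> x = y \/ (om x < om y)%N.
Hypothesis not_up : forall i (y : term (r i)), ~~ up y ->
  exists2 x, up x & y = phi i x.
Hypothesis phi_not_up : forall i x, ~~ up (phi i x).
Hypothesis lead_deg : forall i (a : 'I_(r i.+1)),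
  sh a = (mdeg (lead a).1 + sh (lead a).2)%N.
Hypothesis sh_lt : forall i (a : 'I_(r i.+1)) (b : 'I_(r i)), (sh b < sh a)%N.
Hypothesis sh0 : forall b : 'I_(r 0), sh b = 0%N.
Hypothesis r0 : (0 < r 0)%N.

Local Notation aug v := (\sum_(b < r 0) v 0 b).
Hypothesis L_up : forall v : 'rV[S]_(r 0), supported (@up 0%N) v -> L (aug v) ->
  v = 0.
Hypothesis L_lead : forall a : 'I_(r 1), exists v : 'rV[S]_(r 0),
  [/\ L (aug v), hproj (@sh 0%N) (sh a) v = v & lead_term (@om 0%N) v (lead a)].

Lemma up_inj i (x y : term (r i.+1)) : up x -> up y -> phi i x = phi i y -> x = y.
Proof.
move=> ux uy e; have [//|lt] := om_tie ux e.
by have [//|lt'] := om_tie uy (esym e); move: (ltn_trans lt lt'); rewrite ltnn.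
Qed.

Lemma lead_not_up i (a : 'I_(r i.+1)) : ~~ up (lead a).
Proof.
have := phi_not_up (0%MM, a).
by rewrite /shift_term /= add0m -surjective_pairing.
Qed.

(** The third clause says that normal forms modulo the image of [D] are unique. *)
Definition frame_diff i (D : 'M[S]_(r i.+1, r i)) : Prop :=
  [/\ graded_mx (@sh i.+1) (@sh i) D,
      forall a, lead_term (@om i) (row a D) (lead a)
    & forall u, supported (@up i) u -> (exists w, u = w *m D) -> u = 0].

Lemma frame_start : exists D : 'M[S]_(r 1, r 0),
  frame_diff D /\ forall w : 'rV_(r 1), L (aug (w *m D)).
Proof.
have [w hw] := fin_all_exists L_lead.
have LD0 (u : 'rV_(r 1)) : L (aug (u *m \matrix_a w a)).
  under eq_bigr => b _ do rewrite mxE.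
  rewrite exchange_big; elim/big_ind: _ => // a _.
  under eq_bigr => b _ do rewrite mxE.
  by rewrite -mulr_sumr; apply: LM; have [] := hw a.
exists (\matrix_a w a); split=> //; split.
- by apply/graded_mxP => a; rewrite rowK; have [] := hw a.
- by move=> a; rewrite rowK; have [] := hw a.
- by move=> u hu [w' e]; apply: L_up => //; rewrite e.
Qed.

(** The rows of D' are syzygies of [D], and by [lead_free] no nonzero combination of [up] terms is
    one; this carries the third clause of [frame_diff] to the next level. *)
Lemma frame_next i (D : 'M[S]_(r i.+1, r i)) : frame_diff D ->
  exists D' : 'M[S]_(r i.+2, r i.+1), frame_diff D' /\ D' *m D = 0.
Proof.
move=> [gD lD upD].
have ex a := frame_syzygy (@om_mul i) lD (@not_up i) upD gD (@phi_not_up i)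
  (@lead_not_up i.+1) (@om_phi i) (@om_tie i) (@lead_deg i.+1) a.
have [w hw] := fin_all_exists ex.
have DD : (\matrix_a w a) *m D = 0.
  by apply/row_matrixP => a; rewrite row_mul rowK row0; have [] := hw a.
exists (\matrix_a w a); split=> //; split.
- by apply/graded_mxP => a; rewrite rowK; have [] := hw a.
- by move=> a; rewrite rowK; have [] := hw a.
move=> u hu [w' e]; apply: (lead_free (@om_mul i) lD (@up_inj i)) => //.
by rewrite e -mulmxA DD mulmx0.
Qed.

(** Each matrix must compose to zero with the very matrix chosen before it, hence choice inside a
    recursion on a sigma type. *)
Definition frame_seq : forall i, {D : 'M[S]_(r i.+1, r i) | frame_diff D} :=
  fix F i := match i with
  | 0%N => let: exist D hD :=
        constructive_indefinite_description _ frame_start in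
      exist _ D (proj1 hD)
  | i'.+1 => let: exist D hD := F i' in
      let: exist D' hD' :=
        constructive_indefinite_description _ (frame_next hD) in
      exist _ D' (proj1 hD')
  end.

Definition frame_mx i := sval (frame_seq i).

Lemma frame_mxP i : frame_diff (frame_mx i).
Proof. exact: svalP (frame_seq i). Qed.

Lemma frame_mx0 (w : 'rV_(r 1)) : L (aug (w *m frame_mx 0)).
Proof.
rewrite /frame_mx /=; case: constructive_indefinite_description => D /= [hD].
exact.
Qed.

Lemma frame_mxS i : frame_mx i.+1 *m frame_mx i = 0.
Proof.
rewrite /frame_mx /=; case: (frame_seq i) => D hD.
by case: constructive_indefinite_description => D' /= [].
Qed.

Lemma frame_normal i (v : 'rV[S]_(r i)) :
  exists w u, v = w *m frame_mx i + u /\ supported (@up i) u.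
Proof.
have [c hc] := tcoeff_bound (@om i) v.
have [_ lD _] := frame_mxP i.
have [w [u [e hu _]]] := normal_form (@om_mul i) lD (@not_up i) hc.
by exists w, u.
Qed.

(** In the normal form v = w D + u of a cycle, [u] is a cycle made of [up] terms, hence 0: this is
    exactness. Shifts increase strictly with the level, which forbids constant entries: this is
    minimality. *)
Lemma frame_resolution : exists F : min_graded_free_resolution L,
  forall i j, num_generators F i j = #|[set a : 'I_(r i) | sh a == j]|.
Proof.
have augE (v : 'rV[S]_(r 0)) : (v *m const_mx 1) 0 0 = aug v.
  by rewrite mxE; apply: eq_bigr => b _; rewrite mxE mulr1.
have LB f g : L f -> L g -> L (f - g).
  by move=> hf hg; apply: LD => //; rewrite -mulN1r; apply: LM.
unshelve eexists (@MinRes k n L r sh (const_mx 1) frame_mx _ _ _ _ _ _); last by [].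
- move=> a b m; rewrite mxE msupp1 inE => /eqP ->.
  by rewrite mdeg0 sh0.
- by move=> i; have [] := frame_mxP i.
- move=> f; exists (\row_b if b == Ordinal r0 then f else 0).
  rewrite augE (bigD1 (Ordinal r0)) //= mxE eqxx big1 ?addr0 ?subrr //.
  by move=> b nb; rewrite mxE (negbTE nb).
- move=> v; rewrite augE; split=> [hv|[w ->]]; last exact: frame_mx0.
  have [w [u [e hu]]] := frame_normal v; exists w.
  have u0 : u = 0; last by rewrite e u0 addr0.
  apply: L_up => //.
  have -> : aug u = aug v - aug (w *m frame_mx 0).
    by rewrite -sumrB; apply: eq_bigr => b _; rewrite e mxE [X in X - _]addrC addrK.
  by apply: LB => //; apply: frame_mx0.
- move=> i v; split=> [hv|[w ->]]; last by rewrite -mulmxA frame_mxS mulmx0.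
  have [w [u [e hu]]] := frame_normal v; exists w.
  have u0 : u = 0; last by rewrite e u0 addr0.
  have [_ lD _] := frame_mxP i.
  apply: (lead_free (@om_mul i) lD (@up_inj i)) => //.
  by move: hv; rewrite e mulmxDl -mulmxA frame_mxS mulmx0 add0r.
- move=> i a b; apply/eqP; rewrite mcoeff_eq0; apply/negP.
  have [gD _ _] := frame_mxP i; move/gD; rewrite mdeg0 add0n => e.
  by have := sh_lt a b; rewrite e ltnn.
Qed.

End Frame.

(** * Generators and leading terms of the resolution *)

Section PathFrame.
Variable s : nat.

(* None generates F_0, and Some (a, b, La) is a generator of F_i with
   i = #|La| + 1, lying over the quadric t_a t_b of the initial ideal. *)
Definition gen := option ('I_s * 'I_s * {set 'I_s}).

(* The variables in the colon ideal of t_a t_b by the quadrics t_a' t_b' with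
   (b', a') lexicographically smaller than (b, a). *)
Definition colon (a b : 'I_s) : {set 'I_s} :=
  [set l : 'I_s | [&& l < b, l != a & l != a.+1 :> nat]].

Definition gens (i : nat) : {set gen} :=
  [set g : gen | match g, i with
    | None, 0 => true
    | Some (a, b, La), i'.+1 =>
        [&& a.+1 < b, La \subset colon a b & #|La| == i']
    | _, _ => false
    end].

Definition set_max (La : {set 'I_s}) : option 'I_s :=
  [pick l in La | [forall l' in La, l' <= l]].

(** The leading term of the differential: the largest index of La becomes a coefficient, and for
    empty La it is the quadric t_a t_b itself. *)
Definition gen_lead (g : gen) : 'X_{1..s} * gen :=
  match g with
  | None => (0%MM, None)
  | Some (a, b, La) =>
      if set_max La is Some l then (U_(l)%MM, Some (a, b, La :\ l))
      else ((U_(a) + U_(b))%MM, None)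
  end.

(** The support must be a face of the path 0 - 1 - ... - (s-1), whose Stanley-Reisner ideal is the
    initial ideal. *)
Definition standard (m : 'X_{1..s}) : bool :=
  [forall a : 'I_s, forall b : 'I_s, (a.+1 < b) ==> (m a == 0) || (m b == 0)].

(** The indices that can join La as its new maximum. For such l, t_l times the generator is a
    leading term of the next differential, so [gen_up] forbids t_l. *)
Definition gen_free (t : 'I_s * 'I_s * {set 'I_s}) : {set 'I_s} :=
  [set l in colon t.1.1 t.1.2 | [forall l' in t.2, l' < l]].

Definition gen_up (x : 'X_{1..s} * gen) : bool :=
  if x.2 is Some t then [forall l in gen_free t, x.1 l == 0] else standard x.1.

(* Breaks the ties between terms with the same leading image: the term
   satisfying gen_up must be the smallest one. *)
Definition gen_tie (g : gen) : nat :=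
  match g with
  | None => 0
  | Some (a, b, La) => if set_max La is Some l then s - l else b * s + a
  end.

Definition gen_phi (x : 'X_{1..s} * gen) : 'X_{1..s} * gen :=
  ((x.1 + (gen_lead x.2).1)%MM, (gen_lead x.2).2).

Lemma set_max_eq (La : {set 'I_s}) l :
  l \in La -> (forall l', l' \in La -> l' <= l) -> set_max La = Some l.
Proof.
move=> hl hmax; rewrite /set_max; case: pickP => [l0 /andP[h0 /forall_inP h1]|].
  by congr Some; apply/val_inj/eqP; rewrite eqn_leq hmax //= h1.
by move/(_ l); rewrite hl /= => /negP[]; apply/forall_inP.
Qed.

Lemma set_maxP (La : {set 'I_s}) :
  (La = set0 /\ set_max La = None) \/
  exists l, [/\ l \in La, forall l', l' \in La -> l' <= l & set_max La = Some l].
Proof.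
have [->|[l0 h0]] := set_0Vmem La.
  left; split=> //; rewrite /set_max; case: pickP => // l.
  by rewrite inE.
right; case: (arg_maxnP (@nat_of_ord s) h0) => l hl hmax.
by exists l; split=> //; apply: set_max_eq.
Qed.

Lemma gen_lead_in i g : g \in gens i.+1 -> (gen_lead g).2 \in gens i.
Proof.
rewrite !inE; case: g => [[[a b] La]|//] /and3P[ab sub card] /=.
have [[La0 ->]|[l [hl _ ->]]] := set_maxP La.
  by move: card; rewrite La0 cards0 => /eqP <-.
move: card; rewrite (cardsD1 l) hl => /eqP <- /=.
by rewrite ab eqxx andbT /=; apply: subset_trans sub; rewrite subsetDl.
Qed.

Definition shift_of i := if i is i'.+1 then i'.+2 else 0.

Lemma gen_lead_deg i g : g \in gens i.+1 ->
  shift_of i.+1 = mdeg (gen_lead g).1 + shift_of i.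
Proof.
rewrite !inE; case: g => [[[a b] La]|//] /and3P[ab sub card] /=.
have [[La0 ->]|[l [hl _ ->]]] := set_maxP La.
  by move: card; rewrite La0 cards0 => /eqP <-; rewrite mdegD !mdeg1.
by move: card; rewrite (cardsD1 l) hl => /eqP <-; rewrite mdeg1.
Qed.

Lemma standardPn (m : 'X_{1..s}) : ~~ standard m ->
  exists a b : 'I_s, [/\ a.+1 < b, 0 < m a & 0 < m b].
Proof.
case/forallPn => a /forallPn[b]; rewrite negb_imply negb_or -!lt0n.
by case/and3P => ab ha hb; exists a, b.
Qed.

Lemma gen_phi_not_up i x : x.2 \in gens i.+1 -> ~~ gen_up (gen_phi x).
Proof.
case: x => m [[[a b] La]|]; rewrite !inE //= => /and3P[ab sub _].
rewrite /gen_phi /gen_up /=.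
have [[La0 ->]|[l [hl hmax ->]]] /= := set_maxP La.
  apply/forallPn; exists a; apply/forallPn; exists b.
  rewrite ab /= !mnmDE !mnm1E !eqxx; lia.
apply/forall_inPn; exists l; last by rewrite mnmDE mnm1E eqxx addn1.
rewrite inE /= (subsetP sub) //=; apply/forall_inP => l'; rewrite !inE.
by case/andP => ne /hmax; rewrite leq_eqVlt (inj_eq val_inj) (negbTE ne).
Qed.

(** A nonstandard monomial is divided by its least quadric, pairs being compared as (b, a); a term
    over (a, b, La) gives up its largest free variable, which moves into La. *)
Lemma gen_not_up i x : x.2 \in gens i -> ~~ gen_up x ->
  exists x', [/\ x'.2 \in gens i.+1, gen_up x' & x = gen_phi x'].
Proof.
case: x => m [[[a b] La]|]; rewrite inE; last first.
  case: i => // _; rewrite /gen_up /= => /standardPn[a0 [b0 [ab0 ha0 hb0]]].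
  pose P (t : 'I_s * 'I_s) := [&& t.1.+1 < t.2, 0 < m t.1 & 0 < m t.2].
  have P0 : P (a0, b0) by rewrite /P ab0 ha0 hb0.
  (* [t.2 * s + t.1] codes the lexicographic order on (b, a). *)
  case: (arg_minnP (fun t : 'I_s * 'I_s => t.2 * s + t.1) P0) => -[a b].
  move=> /and3P[/= ab ha hb] hmin.
  have hm : m = (m - (U_(a) + U_(b)) + (U_(a) + U_(b)))%MM.
    rewrite submK //; apply/mnm_lepP => l; rewrite mnmDE !mnm1E.
    have nab : (a == b) = false by apply/eqP => e; move: ab; rewrite e; lia.
    have [<-|na] := eqVneq a l; first by rewrite eq_sym nab.
    by have [<-|nb] := eqVneq b l.
  have max0 : set_max set0 = None.
    by case: (set_maxP set0) => [[]//|[l []]]; rewrite inE.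
  exists ((m - (U_(a) + U_(b)))%MM, Some (a, b, set0)); split.
  - by rewrite inE /= ab sub0set cards0.
  - rewrite /gen_up /=; apply/forall_inP => l; rewrite !inE /= => /andP[] /and3P.
    case=> lb la la1 _; apply/eqP.
    have la' : (l : nat) <> a by move=> /val_inj e; rewrite e eqxx in la.
    (* If t_l divided [m], a smaller pair would exist: (l, b) when l < a, and (a, l) when l > a +
       1. *)
    suff : m l = 0 by rewrite mnmBE => ->.
    apply/eqP; apply: contraT; rewrite -lt0n => hl.
    have h1 := hmin (l, b); have h2 := hmin (a, l).
    have := ltn_ord a; have := ltn_ord b; have := ltn_ord l.
    move: h1 h2; rewrite /P /= hl ha hb !andbT.
    have [lt|ge] := ltnP l.+1 b => h1 h2 *; last nia.
    have h3 := h1 isT; have hal : a < l by lia.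
    have h4 : a.+1 < l by lia.
    have := h2 h4; nia.
  - by rewrite /gen_phi /= max0 /= -hm.
case: i => // i /and3P[ab sub card]; rewrite /gen_up /= => /forall_inPn[l0 h0 m0].
pose P l := (l \in gen_free (a, b, La)) && (m l != 0).
have P0 : P l0 by rewrite /P h0 m0.
case: (arg_maxnP (@nat_of_ord s) P0) => l /andP[hl ml] hmax.
move: (hl); rewrite !inE /= => /andP[hlc /forall_inP hLa].
have nl : l \notin La by apply/negP => /hLa; rewrite ltnn.
have maxl : set_max (l |: La) = Some l.
  apply: set_max_eq; first exact: setU11.
  by move=> l'; rewrite !inE => /orP[/eqP ->//|/hLa /ltnW].
exists ((m - U_(l))%MM, Some (a, b, l |: La)); split.
- rewrite inE /= ab cardsU1 nl (eqP card) eqxx andbT /=.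
  by rewrite subUset sub1set sub andbT inE.
- rewrite /gen_up /=; apply/forall_inP => l'; rewrite inE /=.
  move=> /andP[hc /forall_inP hl'].
  have ll' : l < l' by apply: hl'; exact: setU11.
  rewrite mnmBE; suff -> : m l' = 0 by [].
  apply/eqP; apply: contraT => nz; have := hmax l'.
  rewrite /P nz andbT inE /= hc /= => h; have : l' <= l.
    by apply: h; apply/forall_inP => l2 h2; apply: hl'; rewrite inE h2 orbT.
  by rewrite leqNgt ll'.
- rewrite /gen_phi /= maxl /= setU1K // submK //.
  by rewrite lep1mP.
Qed.

(** If the maxima l and l' differ, t_l' divides the monomial of [x], and l' > l would make it a free
    variable; so l' < l, which is why the tie is [s - l]. For quadrics, [gen_up] makes (b, a) the
    least pair dividing the common image. *)
Lemma gen_phi_tie i x y : x.2 \in gens i.+1 -> y.2 \in gens i.+1 -> gen_up x ->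
  gen_phi x = gen_phi y -> x = y \/ gen_tie x.2 < gen_tie y.2.
Proof.
case: x y => [m [[[a b] La]|]] [m' [[[a' b'] La']|]]; rewrite !inE //=.
move=> /and3P[ab sub card] /and3P[ab' sub' card']; rewrite /gen_up /gen_phi /=.
have [[La0 ->]|[l [hl hmax ->]]] := set_maxP La;
  have [[La0' ->]|[l' [hl' hmax' ->]]] := set_maxP La';
  move=> /= /forall_inP hup; last first.
- move=> e; have /= em := congr1 fst e; have /= := congr1 snd e.
  case=> ea eb eLa; subst a' b'.
  have [ell|nll] := eqVneq l l'.
    left; rewrite -ell in em eLa hl' *; congr (_, Some (_, _)).
      exact: (addIm em).
    by rewrite -(setD1K hl) eLa setD1K.
  right; have ml' : m l' != 0.
    have /mnmP/(_ l') := em; rewrite !mnmDE !mnm1E eqxx (negbTE nll); lia.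
  have : l' < l; last by have := ltn_ord l; lia.
  rewrite ltnNge; apply/negP => le.
  have lt : l < l' by rewrite ltn_neqAle le andbT.
  move: ml'; rewrite hup //= inE (subsetP sub') //=; apply/forall_inP => l2 /hmax.
  by move=> h; apply: leq_ltn_trans lt.
- by case.
- by case.
rewrite La0 La0' => /(congr1 fst) /= em.
(* Below b only t_a and t_(a+1) can divide the common image, as the variables of [colon a b] do not
   divide [m]. *)
have sup (c : 'I_s) : c < b -> 0 < m c + (a == c) + (b == c) ->
    c = a \/ c = a.+1 :> nat.
  move=> cb hc; have [->|nca] := eqVneq c a; first by left.
  have [e|nca1] := eqVneq (c : nat) a.+1; first by right.
  have mc : m c == 0.
    apply: hup; rewrite inE La0 /= inE cb nca nca1 /=.
    by apply/forall_inP => l'; rewrite inE.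
  have nbc : (b == c) = false by apply/eqP => e; move: cb; rewrite e ltnn.
  by move: hc; rewrite (eqP mc) eq_sym (negbTE nca) nbc.
have hm c : m c + (a == c) + (b == c) = m' c + (a' == c) + (b' == c).
  by have /mnmP/(_ c) := em; rewrite !mnmDE !mnm1E !addnA.
have ha' : a' < b -> a' = a \/ a' = a.+1 :> nat.
  by move=> lt; apply: sup => //; rewrite hm eqxx; lia.
have hb' : b' < b -> b' = a \/ b' = a.+1 :> nat.
  by move=> lt; apply: sup => //; rewrite hm eqxx; lia.
have lebb : b <= b'.
  rewrite leqNgt; apply/negP => lt.
  have la' : a' < b by lia.
  have e1 := congr1 (@nat_of_ord s); move: ab'.
  case: (ha' la') => [/e1|] ->; case: (hb' lt) => [/e1|] ->; lia.
have := ltn_ord a; have := ltn_ord a'; have := ltn_ord b; have := ltn_ord b'.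
move: lebb; rewrite leq_eqVlt => /orP[/eqP/val_inj eb|lt]; last by right; nia.
subst b'.
have : a <= a'.
  have la' : a' < b by lia.
  by case: (ha' la') => ->.
rewrite leq_eqVlt => /orP[/eqP/val_inj ea|lt]; last by right; nia.
by subst a'; left; move/addIm: em => ->.
Qed.

Lemma gen_tie_lt g : gen_tie g < (s * s + s).+1.
Proof.
case: g => [[[a b] La]|] //=; case: (set_max La) => [l|]; first by lia.
have := ltn_ord a; have := ltn_ord b; nia.
Qed.

End PathFrame.

(** * Counting the generators *)

Section PathCount.
Variable s : nat.

Lemma card_ord_lt c : c <= s -> #|[set l : 'I_s | l < c]| = c.
Proof.
move=> le; rewrite -sum1dep_card -(big_ord_widen s (fun=> 1) le).
by rewrite sum1_card card_ord.
Qed.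

Lemma card_colon (a b : 'I_s) : a.+1 < b -> #|colon a b| = b.-2.
Proof.
move=> ab; have lt1 : a.+1 < s by have := ltn_ord b; lia.
have := card_ord_lt (ltnW (ltn_ord b)).
rewrite (cardsD1 a) (cardsD1 (Ordinal lt1)) !inE /=.
rewrite -(inj_eq val_inj) /= (ltnW ab) ab eqn_leq ltnn /= => h.
have -> : colon a b = [set l : 'I_s | l < b] :\ a :\ Ordinal lt1; last first.
  by have := congr1 (fun c => c.-2) h.
apply/setP => l; rewrite !inE -!(inj_eq val_inj) /=.
by case: (l < b); case: (l == a :> nat); case: (l == a.+1 :> nat).
Qed.

(** Hockey-stick summation; the truncated [b.-1] at [b = 0] only adds ['C(0, i.+1) = 0]. *)
Lemma sum_bin_pred i : \sum_(b < s) 'C(b.-1, i.+1) = 'C(s.-1, i.+2).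
Proof.
elim: s => [|[|s' IHs]]; first by rewrite big_ord0.
  by rewrite big_ord1 !bin0n.
by rewrite big_ord_recr /= IHs binS.
Qed.

Lemma card_gens i : #|gens s i.+1| = i.+1 * 'C(s.-1, i.+2).
Proof.
pose P (t : 'I_s * 'I_s * {set 'I_s}) :=
  (t.1.1.+1 < t.1.2) && ((t.2 \subset colon t.1.1 t.1.2) && (#|t.2| == i)).
have -> : gens s i.+1 = Some @: [set t | P t].
  apply/setP => -[[[a b] La]|]; last first.
    by rewrite inE; apply/esym/imsetP => -[].
  by rewrite mem_imset; [rewrite !inE | exact: Some_inj].
rewrite card_imset; last exact: Some_inj.
rewrite -sum1dep_card.
rewrite -(pair_big_dep (fun ab : 'I_s * 'I_s => ab.1.+1 < ab.2)
  (fun ab (La : {set 'I_s}) => (La \subset colon ab.1 ab.2) && (#|La| == i))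
  (fun _ _ => 1)) /=.
have e (ab : 'I_s * 'I_s) : ab.1.+1 < ab.2 ->
    \sum_(La : {set 'I_s} | (La \subset colon ab.1 ab.2) && (#|La| == i)) 1
      = 'C(ab.2.-2, i).
  by move=> h; rewrite sum1dep_card cards_draws card_colon.
rewrite (eq_bigr _ e).
rewrite -(pair_big_dep predT (fun a b : 'I_s => a.+1 < b)
  (fun a b => 'C(b.-2, i))) /=.
rewrite (exchange_big_dep predT) //= -sum_bin_pred big_distrr /=.
apply: eq_bigr => b _.
(* Absorption: (b-1) C(b-2, i) = (i+1) C(b-1, i+1), where b-1 counts the possible [a]. *)
rewrite -mul_bin_diag sum_nat_const; congr muln.
transitivity #|[set l : 'I_s | l < b.-1]|.
  by rewrite -sum1dep_card -sum1_card; apply: eq_bigl => a; rewrite unfold_in; lia.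
by apply: card_ord_lt; have := ltn_ord b; lia.
Qed.

End PathCount.

(** * Numerical weights realizing Schreyer's order *)

Section PathWeights.
Variable s : nat.

Definition mweight (m : 'X_{1..s}) : nat := \sum_(l < s) m l * l ^ 2.

(** Larger than every value of [gen_tie], so a tie-break never carries into the higher digits. *)
Definition weight_base := (s * s + s).+1.
Local Notation N := weight_base.

(* Schreyer's order, the weight of the leading image followed by gen_tie, is
   coded by one natural number in base N. *)
Fixpoint gen_weight i (g : gen s) : nat :=
  if i is i'.+1 then
    N * (N ^ i' * mweight (gen_lead g).1 + gen_weight i' (gen_lead g).2)
    + gen_tie g
  else 0.

Definition term_weight i (x : 'X_{1..s} * gen s) : nat :=
  N ^ i * mweight x.1 + gen_weight i x.2.

Lemma mweightD m m' : mweight (m + m')%MM = mweight m + mweight m'.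
Proof.
by rewrite -big_split; apply: eq_bigr => l _; rewrite mnmDE mulnDl.
Qed.

Lemma mweight1 (l : 'I_s) : mweight U_(l)%MM = l ^ 2.
Proof.
rewrite /mweight (bigD1 l) //= mnm1E eqxx mul1n big1 ?addn0 // => l' ne.
by rewrite mnm1E eq_sym (negbTE ne).
Qed.

(** The factor [N ^ i] on the monomial part of [term_weight] matches the powers of [N] accumulated
    in [gen_weight], so Schreyer's recursion holds exactly. *)
Lemma term_weightS i x :
  term_weight i.+1 x = N * term_weight i (gen_phi x) + gen_tie x.2.
Proof. by rewrite /term_weight /= mweightD expnS !mulnDr !mulnA !addnA. Qed.

Lemma term_weight_phi i x y :
  term_weight i (gen_phi x) < term_weight i (gen_phi y) ->
  term_weight i.+1 x < term_weight i.+1 y.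
Proof.
rewrite !term_weightS; have := gen_tie_lt x.2.
rewrite -/weight_base; move: (gen_tie _) (gen_tie _) N; nia.
Qed.

Lemma term_weight_mul i m x y : term_weight i x < term_weight i y ->
  term_weight i ((m + x.1)%MM, x.2) < term_weight i ((m + y.1)%MM, y.2).
Proof. by rewrite /term_weight /= !mweightD !mulnDr -!addnA ltn_add2l. Qed.

End PathWeights.

(** * Resolving an ideal whose initial ideal comes from the path *)

Section PathResolution.
Local Open Scope ring_scope.
Variables (k : fieldType) (s : nat).
Local Notation S := {mpoly k[s]}.
Local Notation rk i := #|gens s i|.

Definition to_gen i (x : 'X_{1..s} * 'I_(rk i)) : 'X_{1..s} * gen s :=
  (x.1, enum_val x.2).

Definition frame_lead i (a : 'I_(rk i.+1)) : 'X_{1..s} * 'I_(rk i) :=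
  ((gen_lead (enum_val a)).1,
   enum_rank_in (gen_lead_in (enum_valP a)) (gen_lead (enum_val a)).2).

Lemma to_gen_inj i : injective (@to_gen i).
Proof. by move=> [m a] [m' a'] [-> /enum_val_inj ->]. Qed.

Lemma to_genP i (x : 'X_{1..s} * 'I_(rk i)) : (to_gen x).2 \in gens s i.
Proof. exact: enum_valP. Qed.

Lemma to_gen_lead i (a : 'I_(rk i.+1)) :
  to_gen (frame_lead a) = gen_lead (enum_val a).
Proof.
rewrite /to_gen /= enum_rankK_in -?surjective_pairing //.
exact: gen_lead_in (enum_valP a).
Qed.

Lemma to_gen_phi i (x : 'X_{1..s} * 'I_(rk i.+1)) :
  to_gen (shift_term (@frame_lead i) x) = gen_phi (to_gen x).
Proof.
rewrite {1}/to_gen /shift_term /gen_phi /=; congr pair.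
by have := congr1 snd (to_gen_lead x.2).
Qed.

Lemma enum_val_gens0 (b : 'I_(rk 0)) : enum_val b = None.
Proof.
have := enum_valP b; rewrite inE; by case: (enum_val b) => [[[]]|].
Qed.

Variable L : S -> Prop.
Hypothesis L0 : L 0.
Hypothesis LD : forall f g, L f -> L g -> L (f + g).
Hypothesis LM : forall f g, L f -> L (g * f).
Hypothesis L_standard : forall f, L f -> {in msupp f, forall m, standard m} ->
  f = 0.
Hypothesis L_quadric : forall a b : 'I_s, (a.+1 < b)%N -> exists g : S,
  [/\ L g, g \is 2.-homog, g@_(U_(a) + U_(b)) = 1
    & forall m, m \in msupp g -> m = (U_(a) + U_(b))%MM \/
        (mweight m < mweight (U_(a) + U_(b)))%N].

(** F_0 has rank one, so its vectors are single polynomials, and the base conditions of the frame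
    become [L_standard] and [L_quadric]. *)
Lemma path_resolution : exists F : min_graded_free_resolution L,
  forall i j, num_generators F i j = (if j == shift_of i then rk i else 0)%N.
Proof.
have rk0 : (0 < rk 0)%N.
  by apply/card_gt0P; exists None; rewrite inE.
have all0 (b b' : 'I_(rk 0)) : b = b'.
  by apply: enum_val_inj; rewrite !enum_val_gens0.
pose b0 := Ordinal rk0.
have sum0 (v : 'rV[S]_(rk 0)) : \sum_(b < rk 0) v 0 b = v 0 b0.
  by rewrite (bigD1 b0) //= big1 ?addr0 // => b; rewrite (all0 b b0) eqxx.
pose om i (x : 'X_{1..s} * 'I_(rk i)) := term_weight i (to_gen x).
pose up i (x : 'X_{1..s} * 'I_(rk i)) := gen_up (to_gen x).
have [||||||||||||||F hF] := @frame_resolution k s L (fun i => rk i) frame_lead om up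
  (fun i _ => shift_of i) => //.
- by move=> i m x y; exact: term_weight_mul.
- by move=> i x y; rewrite /om !to_gen_phi; exact: term_weight_phi.
- move=> i x y ux e.
  have e' : gen_phi (to_gen x) = gen_phi (to_gen y) by rewrite -!to_gen_phi e.
  have [/to_gen_inj|lt] := gen_phi_tie (to_genP x) (to_genP y) ux e'; first by left.
  by right; rewrite /om !term_weightS e' ltn_add2l.
- move=> i y /(gen_not_up (to_genP y))[[m g] [/= hg ug ey]].
  exists (m, enum_rank_in hg g); first by rewrite /up /to_gen /= enum_rankK_in.
  apply: to_gen_inj; rewrite to_gen_phi ey /to_gen /=.
  by rewrite enum_rankK_in.
- by move=> i x; rewrite /up to_gen_phi; apply: gen_phi_not_up (to_genP x).
- move=> i a; exact: gen_lead_deg (enum_valP a).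
- by move=> [|i] a b /=.
- move=> v hv; rewrite sum0 => /L_standard h.
  apply/rowP => b; rewrite (all0 b b0) mxE; apply: h => m.
  rewrite mcoeff_msupp => nz; have := hv (m, b0) nz.
  by rewrite /up /gen_up /to_gen /= enum_val_gens0.
- move=> a; have := enum_valP a; rewrite inE.
  case ea : (enum_val a) => [[[x y] La]|//] /and3P[xy _ /eqP/cards0_eq La0].
  have [g [Lg hg g1 gsup]] := L_quadric xy.
  have el : gen_lead (enum_val a) = ((U_(x) + U_(y))%MM, None).
    rewrite ea La0 /=; case: (set_maxP (set0 : {set 'I_s})) => [[_ ->] //|].
    by move=> [l []]; rewrite inE.
  have := to_gen_lead a; rewrite el => el'.
  exists (\row_b g); split; first by rewrite sum0 mxE.
    apply/rowP => b; apply/mpolyP => m; rewrite !mxE mcoeff_hpart /= addn0.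
    by case: eqP => // /eqP ne; rewrite (dhomog_nemf_coeff hg).
  have -> : frame_lead a = ((U_(x) + U_(y))%MM, b0).
    by apply: to_gen_inj; rewrite el' /to_gen /= enum_val_gens0.
  split; first by rewrite /tcoeff mxE.
  move=> [m b]; rewrite /tcoeff mxE /= -mcoeff_msupp => /gsup[->|lt].
    by left; rewrite (all0 b b0).
  right; rewrite /om /to_gen /= !enum_val_gens0 /term_weight /=.
  by rewrite !expn0 !mul1n !addn0.
exists F => i j; rewrite hF eq_sym; case: eqP => _.
  by rewrite cardsT card_ord.
by apply: eq_card0 => a; rewrite inE.
Qed.

End PathResolution.

(** * The fiber cone of a monomial ideal *)

Section MonomialFiberCone.
Local Open Scope ring_scope.
Variables (k : fieldType) (s : nat) (g : 'I_s -> 'X_{1..2}).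
Local Notation S := {mpoly k[s]}.
Local Notation R := {mpoly k[2]}.
Local Notation I := (ideal_gen predT (fun i => 'X_[g i] : R)).
Local Notation null d := (ideal_mul (@ideal_xy k) (ideal_pow I d)).

Definition cexp (m : 'X_{1..s}) : 'X_{1..2} :=
  \big[mnm_add/0%MM]_(i < s) (g i *+ m i)%MM.

(** The exponents of the monomials in (x,y) I^d: a product of d generators times a nontrivial
    monomial. *)
Definition strictly_above d (u : 'X_{1..2}) : Prop :=
  exists m, [/\ mdeg m = d, (cexp m <= u)%MM & cexp m <> u].

Lemma cexpE m j : cexp m j = (\sum_(i < s) m i * g i j)%N.
Proof. by rewrite mnm_sumE; apply: eq_bigr => i _; rewrite mulmnE mulnC. Qed.

Lemma cexpD m m' : cexp (m + m')%MM = (cexp m + cexp m')%MM.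
Proof.
apply/mnmP => j; rewrite mnmDE !cexpE -big_split.
by apply: eq_bigr => i _; rewrite mnmDE mulnDl.
Qed.

Lemma cexp1 i : cexp U_(i)%MM = g i.
Proof.
apply/mnmP => j; rewrite cexpE (bigD1 i) //= mnm1E eqxx mul1n big1 ?addn0 //.
by move=> l ne; rewrite mnm1E eq_sym (negbTE ne).
Qed.

Lemma msupp_mulP n (p q : {mpoly k[n]}) u : u \in msupp (p * q) ->
  exists u1 u2, [/\ u1 \in msupp p, u2 \in msupp q & u = (u1 + u2)%MM].
Proof.
by case/msuppM_le/allpairsP => -[u1 u2] [h1 h2 e]; exists u1, u2.
Qed.

Lemma msupp_sumP n (T : finType) (P : pred T) (F : T -> {mpoly k[n]}) u :
  u \in msupp (\sum_(i | P i) F i) -> exists2 i, P i & u \in msupp (F i).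
Proof.
rewrite mcoeff_msupp raddf_sum /= => nz.
have [/existsP[i /andP[Pi hi]]|/existsPn h] :=
  boolP [exists i, P i && (u \in msupp (F i))]; first by exists i.
move: nz; rewrite big1 ?eqxx // => i Pi; apply/eqP; rewrite mcoeff_eq0.
by have := h i; rewrite Pi.
Qed.

Lemma ideal_pow_supp d (p : R) : ideal_pow I d p -> forall u, u \in msupp p ->
  exists2 m, mdeg m = d & (cexp m <= u)%MM.
Proof.
elim: d p => [|d IHd] p /=.
  move=> _ u _; exists 0%MM; first exact: mdeg0.
  by apply/mnm_lepP => j; rewrite cexpE big1 // => i _; rewrite mnm0E.
move=> [n [a [b [ha hb ->]]]] u /msupp_sumP[l _] /msupp_mulP[u1 [u2 [h1 h2 ->]]].
have [m hm le] := IHd _ (hb l) u2 h2.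
have [h eh] := ha l; move: h1; rewrite eh.
case/msupp_sumP => i _ /msupp_mulP[v1 [v2 [_ hv ->]]].
move: hv; rewrite msuppX inE => /eqP ->.
exists (m + U_(i))%MM; first by rewrite mdegD mdeg1 hm addn1.
rewrite cexpD cexp1; apply/mnm_lepP => j; rewrite !mnmDE.
by have /mnm_lepP/(_ j) := le; lia.
Qed.

Lemma null_supp d (p : R) : null d p ->
  forall u, u \in msupp p -> strictly_above d u.
Proof.
move=> [n [a [b [ha hb ->]]]] u /msupp_sumP[l _] /msupp_mulP[u1 [u2 [h1 h2 ->]]].
have [m hm le] := ideal_pow_supp (hb l) h2.
have [h eh] := ha l; move: h1; rewrite eh.
case/msupp_sumP => i _ /msupp_mulP[v1 [v2 [_ hv ->]]].
move: hv; rewrite msuppX inE => /eqP ->.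
exists m; split=> //.
  by apply/mnm_lepP => j; rewrite mnmDE; have /mnm_lepP/(_ j) := le; lia.
move/mnmP/(_ i); rewrite !mnmDE mnm1E eqxx.
by have /mnm_lepP/(_ i) := le; lia.
Qed.

Lemma ideal_gen_X n (T : finType) (P : pred T) (f : T -> 'X_{1..n}) i u :
  P i -> (f i <= u)%MM ->
  ideal_gen P (fun i => 'X_[f i] : {mpoly k[n]}) 'X_[u].
Proof.
move=> Pi le; exists (fun j => if j == i then 'X_[u - f i] else 0).
rewrite (bigD1 i) //= eqxx -mpolyXD submK // big1 ?addr0 // => j /andP[_ ne].
by rewrite (negbTE ne) mul0r.
Qed.

Lemma ideal_mul_intro (J K : R -> Prop) a b : J a -> K b -> ideal_mul J K (a * b).
Proof.
move=> ha hb; exists 1%N, (fun _ => a), (fun _ => b).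
by split=> //; rewrite big_ord1.
Qed.

Lemma ideal_pow_X d u m : mdeg m = d -> (cexp m <= u)%MM ->
  ideal_pow I d 'X_[u].
Proof.
elim: d u m => [//|d IHd] u m hm le.
have [i hi] : exists i, m i != 0%N.
  apply/existsP; apply: contraTT isT => /existsPn h.
  suff : mdeg m = 0%N by rewrite hm.
  by rewrite mdegE big1 // => i _; apply/eqP; have := h i; rewrite negbK.
have em : m = (m - U_(i) + U_(i))%MM by rewrite submK // lep1mP.
have lei : (g i <= u)%MM.
  apply: lepm_trans le; rewrite em cexpD cexp1; exact: lem_addl.
have -> : u = (g i + (u - g i))%MM by rewrite addmC submK.
rewrite mpolyXD; apply: ideal_mul_intro.
  by apply: (ideal_gen_X (P := predT) (i := i)) => //; apply: lepm_refl.
apply: (IHd _ (m - U_(i))%MM).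
  by move: hm; rewrite em mdegD mdeg1 addn1 addmK => -[].
apply/mnm_lepP => j; move/mnm_lepP/(_ j): le; rewrite {1}em cexpD cexp1 mnmDE mnmBE.
lia.
Qed.

Lemma ideal_mul0 (J K : R -> Prop) : ideal_mul J K 0.
Proof.
exists 0%N, (fun _ => 0), (fun _ => 0).
by split=> [[]|[]|]; rewrite ?big_ord0.
Qed.

Lemma ideal_mulD (J K : R -> Prop) p q :
  ideal_mul J K p -> ideal_mul J K q -> ideal_mul J K (p + q).
Proof.
move=> [n [a [b [ha hb ->]]]] [n' [a' [b' [ha' hb' ->]]]].
exists (n + n')%N, (fun l => match split l with inl i => a i | inr i => a' i end),
  (fun l => match split l with inl i => b i | inr i => b' i end).
split=> [l|l|]; [by case: split|by case: split|].
rewrite big_split_ord /=; congr (_ + _); apply: eq_bigr => l _.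
  by rewrite (unsplitK (inl l)).
by rewrite (unsplitK (inr l)).
Qed.

Lemma nullZ d c p : null d p -> null d (c *: p).
Proof.
move=> [n [a [b [ha hb ->]]]].
exists n, (fun l => c *: a l), b; split=> // [l|].
  have [h ->] := ha l; exists (fun i => c *: h i).
  by rewrite scaler_sumr; apply: eq_bigr => i _; rewrite scalerAl.
by rewrite scaler_sumr; apply: eq_bigr => i _; rewrite scalerAl.
Qed.

Lemma nullP d (p : R) :
  null d p <-> forall u, u \in msupp p -> strictly_above d u.
Proof.
split=> [|h]; first exact: null_supp.
rewrite (mpolyE p) big_seq; elim/big_ind: _ => [|a b|u /h[m [hm le ne]]].
- exact: ideal_mul0.
- exact: ideal_mulD.
apply: nullZ.
have -> : u = (u - cexp m + cexp m)%MM by rewrite submK.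
rewrite mpolyXD; apply: ideal_mul_intro; last first.
  by apply: (ideal_pow_X hm); apply: lepm_refl.
have [i hi] : exists i, (u - cexp m)%MM i != 0%N.
  apply/existsP; apply: contraTT isT => /existsPn h0; case: ne.
  apply/mnmP => i; have := h0 i; rewrite negbK mnmBE.
  by have /mnm_lepP/(_ i) := le; lia.
by apply: (ideal_gen_X (P := predT) (i := i)) => //; rewrite lep1mP.
Qed.

Local Notation rees := (rees_map (fun i => 'X_[g i] : R)).
Local Notation L := (fiber_cone_ideal (fun i => 'X_[g i] : R)).

(** [rees_map] is a bare function; this is the same map with its ring morphism structure. *)
Let rees_morph : {rmorphism S -> {poly R}} :=
  mmap (polyC \o @mpolyC 2 k) (fun i => 'X_[g i]%:P * 'X).

Let reesE (f : S) : rees f = rees_morph f. Proof. by []. Qed.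

Lemma rees_mapB (f f' : S) : rees (f - f') = rees f - rees f'.
Proof. by rewrite !reesE raddfB. Qed.

Lemma rees_X m : rees ('X_[m] : S) = 'X_[cexp m]%:P * 'X^(mdeg m).
Proof.
rewrite reesE /= mmapX /mmap1 /cexp.
under eq_bigr => i _ do rewrite exprMn -rmorphXn /= mpolyXn.
rewrite big_split /= -rmorph_prod /= prodrXr -mdegE; congr (_%:P * _).
by rewrite (big_morph _ (@mpolyXD 2 k) (@mpolyX0 2 k)).
Qed.

Lemma coef_rees_X c m d : (rees (c *: 'X_[m] : S))`_d =
  if mdeg m == d then c *: 'X_[cexp m] else 0.
Proof.
have -> : rees (c *: 'X_[m] : S) = (c%:MP)%:P * rees ('X_[m] : S).
  by rewrite !reesE /= mmapZ.
rewrite rees_X mulrA -polyCM coefCM coefXn mul_mpolyC eq_sym.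
by case: eqP => _; rewrite ?mulr1 ?mulr0.
Qed.

Lemma coef_rees (f : S) d : (rees f)`_d =
  \sum_(m <- msupp f | mdeg m == d) f@_m *: 'X_[cexp m].
Proof.
rewrite [in LHS](mpolyE f) reesE raddf_sum coef_sum [RHS]big_mkcond /=.
by apply: eq_bigr => m _; rewrite -coef_rees_X.
Qed.

Lemma fiber_cone_idealP (f : S) : L f <->
  forall d u, u \in msupp (rees f)`_d -> strictly_above d u.
Proof. by split=> h d; apply/nullP/h. Qed.

(** Such a binomial already vanishes in the Rees algebra, whereas the monomials of
    [fiber_cone_ideal_monomial] die only in the fiber cone. *)
Lemma fiber_cone_ideal_binomial m m' :
  mdeg m = mdeg m' -> cexp m = cexp m' -> L ('X_[m] - 'X_[m']).
Proof.
move=> ed ec d.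
have -> : rees ('X_[m] - 'X_[m']) = 0.
  by rewrite rees_mapB !rees_X ed ec subrr.
by rewrite coef0; apply: ideal_mul0.
Qed.

Lemma fiber_cone_ideal_monomial m :
  strictly_above (mdeg m) (cexp m) -> L 'X_[m].
Proof.
move=> h d; rewrite rees_X coefCM coefXn; case: eqP => [->|_].
  by rewrite mulr1; apply/nullP => u; rewrite msuppX inE => /eqP ->.
by rewrite mulr0; apply: ideal_mul0.
Qed.

Lemma fiber_cone_ideal0 : L 0.
Proof. by move=> d; rewrite reesE raddf0 coef0; apply: ideal_mul0. Qed.

Lemma fiber_cone_idealD f f' : L f -> L f' -> L (f + f').
Proof.
by move=> h h' d; rewrite reesE raddfD coefD; apply: ideal_mulD; [exact: h|exact: h'].
Qed.

(** Every exponent in the coefficient of T^j in [rees q] is that of a product of j generators;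
    adding it to an exponent strictly above another keeps the inequality strict. *)
Lemma fiber_cone_idealM f q : L f -> L (q * f).
Proof.
move=> /fiber_cone_idealP h; apply/fiber_cone_idealP => d u.
rewrite reesE rmorphM coefM => /msupp_sumP[[j /= ltj] _].
case/msupp_mulP => u1 [u2 [h1 /h[m [hm le ne]] ->]].
move: h1; rewrite -reesE coef_rees mcoeff_msupp raddf_sum /= => nz.
have [m' hm' eu] : exists2 m', mdeg m' = j & cexp m' = u1.
  have [/hasP[m' _ /andP[/eqP hd /eqP hc]]|/hasPn hn] :=
    boolP (has (fun m' => (mdeg m' == j) && (cexp m' == u1)) (msupp q)).
    by exists m'.
  move: nz; rewrite big_seq_cond big1 ?eqxx // => m' /andP[/hn hh hd].
  by move: hh; rewrite hd /= mcoeffZ mcoeffX => /negbTE ->; rewrite mulr0.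
exists (m' + m)%MM; split; first by rewrite mdegD hm hm' subnKC.
  apply/mnm_lepP => i; rewrite cexpD eu !mnmDE.
  by have /mnm_lepP/(_ i) := le; lia.
by rewrite cexpD eu => /addmI.
Qed.

(** The power of T records the degree in the t_i, so the projection keeps just one coefficient of
    [rees f]. *)
Lemma fiber_cone_ideal_homog d f : L f -> L (pihomog mdeg d f).
Proof.
move=> h e.
have -> : (rees (pihomog mdeg d f))`_e = if e == d then (rees f)`_e else 0.
  rewrite pihomogE reesE raddf_sum coef_sum /=.
  under eq_bigr => m _ do rewrite -reesE coef_rees_X.
  rewrite -big_mkcondr; have [->|ne] := eqVneq e d.
    by rewrite coef_rees; apply: eq_bigl => m; rewrite andbb.
  by rewrite big1 // => m /andP[/eqP -> /eqP e0]; rewrite e0 eqxx in ne.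
by case: ifP => _; [exact: h | exact: ideal_mul0].
Qed.

End MonomialFiberCone.

(** * Convex sequences *)

(** Monotonicity of the increments of a convex sequence, in additive form to avoid truncated
    subtraction. *)
Lemma convex_diff (x : nat -> nat) N :
  (forall i, i.+2 < N -> 2 * x i.+1 <= x i + x i.+2) ->
  forall i j, i <= j -> j.+1 < N -> x i.+1 + x j <= x i + x j.+1.
Proof.
move=> h i; elim=> [|j IHj]; first by rewrite leqn0 => /eqP ->; lia.
rewrite leq_eqVlt => /orP[/eqP ->|lt] ltN; first by lia.
have := IHj lt (ltnW ltN); have := h j ltN; lia.
Qed.

(** The coefficients form the positive normal of the edge from a to a+1, whose ends get the same
    value. Moving away from the edge the value never drops: from left to right the increments of x
    grow and the decrements of y shrink. *)
Lemma convex_support (x y : nat -> nat) N a :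
  (forall i, i.+2 < N -> 2 * x i.+1 <= x i + x i.+2) ->
  (forall i, i.+2 < N -> 2 * y i.+1 <= y i + y i.+2) ->
  (forall i, i.+1 < N -> x i < x i.+1) ->
  (forall i, i.+1 < N -> y i.+1 < y i) ->
  a.+1 < N -> forall i, i < N ->
  (y a - y a.+1) * x a + (x a.+1 - x a) * y a <=
  (y a - y a.+1) * x i + (x a.+1 - x a) * y i.
Proof.
move=> cx cy mx my aN.
have dx := convex_diff cx; have dy := convex_diff cy.
have up n : a + n < N ->
  (y a - y a.+1) * x a + (x a.+1 - x a) * y a <=
  (y a - y a.+1) * x (a + n) + (x a.+1 - x a) * y (a + n).
  elim: n => [|n IHn]; first by rewrite addn0.
  rewrite addnS => lt; have := IHn (ltnW lt).
  have := dx a (a + n) (leq_addr _ _) lt; have := dy a (a + n) (leq_addr _ _) lt.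
  have := mx _ aN; have := my _ aN; have := mx _ lt; have := my _ lt.
  move: (x a) (x a.+1) (y a) (y a.+1) (x (a + n)) (y (a + n)) => x0 x1 y0 y1 x2 y2.
  move: (x _) (y _) => x3 y3 *; nia.
have down n : n <= a ->
  (y a - y a.+1) * x a + (x a.+1 - x a) * y a <=
  (y a - y a.+1) * x (a - n) + (x a.+1 - x a) * y (a - n).
  elim: n => [|n IHn]; first by rewrite subn0.
  move=> lt; have := IHn (ltnW lt).
  have e : a - n = (a - n.+1).+1 by lia.
  have l1 : (a - n.+1).+1 < N by lia.
  have le : a - n.+1 <= a by lia.
  rewrite e; have := dx _ _ le aN; have := dy _ _ le aN.
  have := mx _ aN; have := my _ aN; have := mx _ l1; have := my _ l1.
  move: (x a) (x a.+1) (y a) (y a.+1) (x (a - n.+1).+1) (y (a - n.+1).+1)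
    => x0 x1 y0 y1 x2 y2.
  move: (x _) (y _) => x3 y3 *; nia.
move=> i iN; have [le|lt] := leqP a i.
  by have := up (i - a); rewrite subnKC //; apply.
by have := down (a - i); rewrite subKn ?leq_subr ?(ltnW lt) //; apply.
Qed.

Section ConvexExponents.
Variables (N : nat) (x y : 'I_N.+1 -> nat).
Hypothesis cvx : forall i j l : 'I_N.+1, j = i.+1 :> nat -> l = j.+1 :> nat ->
  2 * x j <= x i + x l /\ 2 * y j <= y i + y l.
Hypothesis x_incr : forall i j : 'I_N.+1, i < j -> x i < x j.
Hypothesis y_decr : forall i j : 'I_N.+1, i < j -> y j < y i.
Implicit Types m : 'X_{1..N.+1}.

Let x' i := x (inord i).
Let y' i := y (inord i).

Local Lemma cvx_x i : i.+2 < N.+1 -> 2 * x' i.+1 <= x' i + x' i.+2.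
Proof. by move=> lt; apply: (proj1 (cvx _ _)); rewrite !inordK //; lia. Qed.

Local Lemma cvx_y i : i.+2 < N.+1 -> 2 * y' i.+1 <= y' i + y' i.+2.
Proof. by move=> lt; apply: (proj2 (cvx _ _)); rewrite !inordK //; lia. Qed.

(** The increment at [a] is at most the one at [b1]; this comparison is the source of all quadrics
    in L. *)
Lemma convex_balanced (a b a1 b1 : 'I_N.+1) : a.+1 < b ->
  a1 = a.+1 :> nat -> b = b1.+1 :> nat ->
  x a1 + x b1 <= x a + x b /\ y a1 + y b1 <= y a + y b.
Proof.
move=> ab ea eb; rewrite -(inord_val a1) -(inord_val b1) -(inord_val a).
rewrite -(inord_val b) ea eb.
have le : a <= b1 by lia.
have lt : b1.+1 < N.+1 by rewrite -eb.
by split; [apply: (convex_diff cvx_x)|apply: (convex_diff cvx_y)].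
Qed.

Definition wsum (f : 'I_N.+1 -> nat) m := \sum_i m i * f i.

Lemma standard_edge m : 0 < N -> standard m ->
  exists a a1 : 'I_N.+1, a1 = a.+1 :> nat /\
    forall l, l != a -> l != a1 -> m l = 0.
Proof.
move=> N0 /forallP hm.
have [/existsP[l0 h0]|/existsPn hn] := boolP [exists l, m l != 0]; last first.
  exists ord0, (inord 1); split; first by rewrite inordK.
  by move=> l _ _; apply/eqP; have := hn l; rewrite negbK.
case: (arg_minnP (P := fun l => m l != 0) (@nat_of_ord _) h0) => a ha amin.
have lo (l : 'I_N.+1) : l < a -> m l = 0.
  by move=> lt; apply/eqP; apply: contraTT lt => /amin; rewrite -leqNgt.
have hi (l : 'I_N.+1) : a.+1 < l -> m l = 0.
  move=> lt; have /forallP/(_ l) := hm a.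
  by rewrite lt (negbTE ha) => /eqP.
have [lt|ge] := ltnP a.+1 N.+1.
  exists a, (Ordinal lt); split=> // l; rewrite -!(inj_eq val_inj) /= => n1 n2.
  by have [/lo //|ge] := ltnP l a; apply: hi; lia.
(* Here the support is the last index alone, so the edge must end there instead of starting
   there. *)
have ltp : a.-1 < N.+1 by have := ltn_ord a; lia.
exists (Ordinal ltp), a; split=> [/=|l]; first by lia.
rewrite -!(inj_eq val_inj) /= => n1 n2.
by apply: lo; have := ltn_ord l; lia.
Qed.

Lemma wsum_edge f m (a a1 : 'I_N.+1) : a1 = a.+1 :> nat ->
  (forall l, l != a -> l != a1 -> m l = 0) -> wsum f m = m a * f a + m a1 * f a1.
Proof.
move=> ea h; have ne : a1 != a by rewrite -(inj_eq val_inj) /= ea; lia.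
rewrite /wsum (bigD1 a) //= (bigD1 a1) //= big1 ?addn0 //.
by move=> l /andP[n1 n2]; rewrite h.
Qed.

Lemma wsum1 m : wsum (fun=> 1) m = mdeg m.
Proof. by rewrite mdegE; apply: eq_bigr => l _; rewrite muln1. Qed.

Lemma mnm_single m m' : N = 0 -> mdeg m = mdeg m' -> m = m'.
Proof.
move=> N0; rewrite !mdegE; case: _ / (esym N0) m m' => m m'.
rewrite !big_ord1 => e; apply/mnmP => i; by rewrite ord1.
Qed.

(** The supporting functional of the edge carrying [m] takes on [m] its minimum times the degree, a
    lower bound for its value on m'. Its coefficients [la] and [mu] are positive, so neither sum can
    drop while the other does not rise. *)
Lemma standard_minimal m m' : standard m -> mdeg m' = mdeg m ->
  wsum x m' <= wsum x m -> wsum y m' <= wsum y m ->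
  wsum x m' = wsum x m /\ wsum y m' = wsum y m.
Proof.
have [N0 _ e _ _|N0] := posnP N; first by rewrite (mnm_single N0 e).
move=> /(standard_edge N0)[a [a1 [ea hm]]] ed lex ley.
set la := y a - y a1; set mu := x a1 - x a.
have lt : a < a1 by rewrite ea.
have hx := x_incr lt; have hy := y_decr lt.
have supp i : la * x a + mu * y a <= la * x i + mu * y i.
  have aN : a.+1 < N.+1 by rewrite -ea.
  have := @convex_support x' y' N.+1 a cvx_x cvx_y _ _ aN i (ltn_ord i).
  rewrite /x' /y' -ea !inord_val; apply=> j lt'.
    by apply: x_incr; rewrite !inordK //; lia.
  by apply: y_decr; rewrite !inordK //; lia.
have wD p : la * wsum x p + mu * wsum y p = wsum (fun i => la * x i + mu * y i) p.
  rewrite /wsum !big_distrr -big_split; apply: eq_bigr => i _ /=.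
  by rewrite mulnDr !(mulnCA (p i)).
have le : (la * x a + mu * y a) * mdeg m' <= wsum (fun i => la * x i + mu * y i) m'.
  rewrite -wsum1 /wsum big_distrr; apply: leq_sum => i _ /=.
  by rewrite muln1 mulnC leq_mul.
have eq : wsum (fun i => la * x i + mu * y i) m = (la * x a + mu * y a) * mdeg m.
  rewrite -wsum1 !(wsum_edge _ ea hm) !muln1 /la /mu; nia.
move: le; rewrite ed -eq -!wD => le.
have la0 : 0 < la by rewrite subn_gt0.
have mu0 : 0 < mu by rewrite subn_gt0.
move: (wsum x m) (wsum x m') (wsum y m) (wsum y m') la mu
  la0 mu0 lex ley le {supp wD eq}.
move=> X X' Y Y' la mu *; nia.
Qed.

(** On the edge from a to a+1 the x-sum per unit of degree lies between x_a and x_(a+1). These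
    intervals overlap at most in endpoints, and on a single edge degree and x-sum determine both
    exponents. *)
Lemma standard_inj m m' : standard m -> standard m' -> mdeg m = mdeg m' ->
  wsum x m = wsum x m' -> m = m'.
Proof.
have [N0 _ _ e _|N0] := posnP N; first exact: mnm_single e.
suff key (p p' : 'X_{1..N.+1}) (a a1 a' a1' : 'I_N.+1) :
    a1 = a.+1 :> nat -> a1' = a'.+1 :> nat ->
    (forall l, l != a -> l != a1 -> p l = 0) ->
    (forall l, l != a' -> l != a1' -> p' l = 0) ->
    a <= a' -> mdeg p = mdeg p' -> wsum x p = wsum x p' -> p = p'.
  move=> /(standard_edge N0)[a [a1 [ea hm]]] /(standard_edge N0)[a' [a1' [ea' hm']]].
  move=> ed ex; have [le|lt] := leqP a a'; first exact: (key _ _ a a1 a' a1').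
  by apply/esym/(key _ _ a' a1' a a1) => //; apply: ltnW.
move=> ea ea' hp hp' le; rewrite -!wsum1.
rewrite !(wsum_edge _ ea hp) !(wsum_edge _ ea' hp') !muln1 => ed ex.
have hx : x a < x a1 by apply: x_incr; rewrite ea.
have hx' : x a' < x a1' by apply: x_incr; rewrite ea'.
apply/mnmP => l.
move: le; rewrite leq_eqVlt => /orP[/eqP/val_inj eaa|lt].
  subst a'; have e1 : a1' = a1 by apply: val_inj; rewrite /= ea ea'.
  subst a1'; have ea0 : p a = p' a by nia.
  have ea1 : p a1 = p' a1 by lia.
  have [->//|n1] := eqVneq l a; have [->//|n2] := eqVneq l a1.
  by rewrite hp ?hp'.
(* For distinct edges, equal x-sums push [p] to its right end and p' to its left end. *)
have le1 : x a1 <= x a'.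
  have : a1 <= a' by lia.
  by rewrite leq_eqVlt => /orP[/eqP/val_inj ->//|/x_incr /ltnW].
have p0 : p a = 0 by nia.
have p1 : p' a1' = 0 by nia.
have [e1|n1] := eqVneq a1 a'.
  subst a'; have [->|na1] := eqVneq l a1; first by lia.
  have -> : p l = 0 by have [->//|na] := eqVneq l a; apply: hp.
  by have [->|na] := eqVneq l a1'; rewrite ?p1 // hp'.
(* Without a common vertex, equality of the sums leaves only the monomial 1. *)
have lt1 : x a1 < x a'.
  by apply: x_incr; rewrite ltn_neqAle (inj_eq val_inj) n1 ea.
have p2 : p a1 = 0 by nia.
have p3 : p' a' = 0 by nia.
have -> : p l = 0.
  have [->//|na] := eqVneq l a; have [->//|na1] := eqVneq l a1; exact: hp.
have [->|na] := eqVneq l a'; first by rewrite p3.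
have [->|na1] := eqVneq l a1'; first by rewrite p1.
by rewrite hp'.
Qed.

End ConvexExponents.

(** * The fiber cone of a convex ideal *)

Section ConvexFiberCone.
Local Open Scope ring_scope.
Variables (k : fieldType) (N : nat) (c : 'I_N.+1 -> nat * nat).
Hypothesis hconv : convex_seq c.
Hypothesis hmin : minimal_generators (fun i => monomial_xy k (c i)).

Definition point_exp (p : nat * nat) : 'X_{1..2} :=
  (U_(ord0) *+ p.1 + U_(ord_max) *+ p.2)%MM.

Lemma point_exp0 p : point_exp p ord0 = p.1.
Proof. by rewrite mnmDE !mulmnE !mnm1E mul1n mul0n addn0. Qed.

Lemma point_exp1 p : point_exp p ord_max = p.2.
Proof. by rewrite mnmDE !mulmnE !mnm1E mul1n mul0n. Qed.

Lemma monomial_xyE p : monomial_xy k p = 'X_[point_exp p].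
Proof. by rewrite /monomial_xy !mpolyXn -mpolyXD. Qed.

Lemma mnm2P (P : 'I_2 -> Prop) : P ord0 -> P ord_max -> forall i, P i.
Proof.
move=> h0 h1 [[|[|//]] lt].
  by rewrite (_ : Ordinal lt = ord0) //; apply: val_inj.
by rewrite (_ : Ordinal lt = ord_max) //; apply: val_inj.
Qed.

Local Notation x := (fun i => (c i).1).
Local Notation y := (fun i => (c i).2).
Local Notation g := (fun i => point_exp (c i)).

Lemma generators_incomparable (i j : 'I_N.+1) : i != j ->
  ~ ((x i <= x j)%N /\ (y i <= y j)%N).
Proof.
move=> ne [lx ly]; apply: (hmin (i := j)).
have -> : (fun i => monomial_xy k (c i)) = (fun i => 'X_[g i]).
  by apply: functional_extensionality => l; rewrite monomial_xyE.
rewrite monomial_xyE; apply: (ideal_gen_X k (i := i) (P := fun l => l != j)) => //.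
by apply/mnm_lepP; apply: mnm2P; rewrite ?point_exp0 ?point_exp1.
Qed.

(** The first coordinates increase weakly, so by incomparability a later point must lie strictly
    lower; strictness of the first coordinates then follows in turn. *)
Lemma generators_y_decr (i j : 'I_N.+1) : (i < j)%N -> (y j < y i)%N.
Proof.
move=> lt; rewrite ltnNge; apply/negP => le.
apply: (@generators_incomparable i j).
  by rewrite -(inj_eq val_inj) neq_ltn lt.
by split=> //; apply: (proj1 hconv); apply: ltnW.
Qed.

Lemma generators_x_incr (i j : 'I_N.+1) : (i < j)%N -> (x i < x j)%N.
Proof.
move=> lt; rewrite ltnNge; apply/negP => le.
apply: (@generators_incomparable j i).
  by rewrite -(inj_eq val_inj) neq_ltn lt orbT.
by split=> //; apply: ltnW; apply: generators_y_decr.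
Qed.

Local Notation L := (fiber_cone_ideal (fun i => 'X_[g i] : {mpoly k[2]})).

Lemma cexp_x m : cexp g m ord0 = wsum x m.
Proof. by rewrite cexpE; apply: eq_bigr => i _; rewrite point_exp0. Qed.

Lemma cexp_y m : cexp g m ord_max = wsum y m.
Proof. by rewrite cexpE; apply: eq_bigr => i _; rewrite point_exp1. Qed.

(** By [standard_inj] nothing cancels between standard monomials of equal degree in the Rees
    algebra, and by [standard_minimal] no exponent so obtained is strictly above a product of
    equally many generators. *)
Lemma fiber_cone_standard f : L f -> {in msupp f, forall m, standard m} -> f = 0.
Proof.
move=> /fiber_cone_idealP Lf hstd; apply/eqP; rewrite -msupp_eq0.
case e : (msupp f) => [//|m0 r]; exfalso.
have hm0 : m0 \in msupp f by rewrite e inE eqxx.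
have st0 := hstd m0 hm0.
have : cexp g m0 \in msupp (rees_map (fun i => 'X_[g i] : {mpoly k[2]}) f)`_(mdeg m0).
  rewrite coef_rees mcoeff_msupp raddf_sum /=.
  rewrite big_mkcond (bigD1_seq m0) ?msupp_uniq //= eqxx mcoeffZ mcoeffX eqxx mulr1.
  rewrite big_seq_cond big1 ?addr0 -?mcoeff_msupp //.
  move=> m /andP[hm ne]; case: eqP => // ed; rewrite mcoeffZ mcoeffX.
  case: eqP => [/mnmP/(_ ord0)|]; last by rewrite mulr0.
  rewrite !cexp_x => ex; case/eqP: ne.
  apply: (@standard_inj N x generators_x_incr) => //.
  exact: hstd.
move/Lf => [m [hd /mnm_lepP le]]; apply.
have := le ord0; have := le ord_max; rewrite !cexp_x !cexp_y => ly lx.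
have [ex ey] := @standard_minimal N x y (proj2 hconv)
    generators_x_incr generators_y_decr _ _ st0 hd lx ly.
by apply/mnmP; apply: mnm2P; rewrite ?cexp_x ?cexp_y.
Qed.

Lemma fiber_cone_quadric (a b : 'I_N.+1) : (a.+1 < b)%N ->
  exists q : {mpoly k[N.+1]},
  [/\ L q, q \is 2.-homog, q@_(U_(a) + U_(b)) = 1
    & forall m, m \in msupp q -> m = (U_(a) + U_(b))%MM \/
        (mweight m < mweight (U_(a) + U_(b)))%N].
Proof.
move=> ab.
have lta : (a.+1 < N.+1)%N by have := ltn_ord b; lia.
have ltb : (b.-1 < N.+1)%N by have := ltn_ord b; lia.
pose a1 := Ordinal lta; pose b1 := Ordinal ltb.
have eb : b = b1.+1 :> nat by rewrite /=; lia.
have [hx hy] := @convex_balanced N x y (proj2 hconv) a b a1 b1 ab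
  (erefl : a1 = a.+1 :> nat) eb.
pose u := (U_(a) + U_(b))%MM; pose v := (U_(a1) + U_(b1))%MM.
have deg2 i j : mdeg (U_(i) + U_(j) : 'X_{1..N.+1})%MM = 2%N.
  by rewrite mdegD !mdeg1.
have du : mdeg u = 2%N := deg2 a b.
have dv : mdeg v = 2%N := deg2 a1 b1.
(* The weight drops by 2(b - a - 1). *)
have lw : (mweight v < mweight u)%N.
  by rewrite !mweightD !mweight1 /=; nia.
have hle : (cexp g v <= cexp g u)%MM.
  by apply/mnm_lepP; rewrite !cexpD !cexp1; apply: mnm2P;
    rewrite [leqLHS]mnmDE [leqRHS]mnmDE ?point_exp0 ?point_exp1.
(* Equal exponents give a binomial relation; otherwise t_a t_b itself lies in L, its image being a
   proper multiple of that of t_(a+1) t_(b-1). *)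
have [e|ne] := eqVneq (cexp g v) (cexp g u).
  exists ('X_[u] - 'X_[v]); split.
  - by apply: fiber_cone_ideal_binomial; rewrite ?du ?dv.
  - by apply: rpredB; rewrite dhomogX; apply/eqP.
  - rewrite mcoeffB !mcoeffX eqxx (_ : (v == u) = false) ?subr0 //.
    by apply/eqP => ev; move: lw; rewrite ev ltnn.
  - move=> m /msuppB_le; rewrite mem_cat !msuppX !inE.
    by case/orP => /eqP ->; [left|right].
exists 'X_[u]; split.
- apply: fiber_cone_ideal_monomial; exists v; split=> //; last exact/eqP.
  exact: etrans dv (esym du).
- by rewrite dhomogX; apply/eqP.
- by rewrite mcoeffX eqxx.
- by move=> m; rewrite msuppX inE => /eqP; left.
Qed.

End ConvexFiberCone.

Theorem proposition1p3 (k : fieldType) (s : nat) (hs : (0 < s)%N)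
  (c : 'I_s -> nat * nat) (hconv : convex_seq c)
  (hmin : minimal_generators (fun i : 'I_s => monomial_xy k (c i))) :
  let L := fiber_cone_ideal (fun i : 'I_s => monomial_xy k (c i)) in
  graded_betti L 0 0 = 1%N /\
  (forall i : nat, (1 <= i)%N ->
     graded_betti L i i.+1 = (i * 'C(s.-1, i.+1))%N /\
     (forall j : nat, j <> i.+1 -> graded_betti L i j = 0%N)).
Proof.
case: s hs c hconv hmin => [//|N] _ c hconv hmin /=.
have quadric := fiber_cone_quadric k hconv.
have std := fiber_cone_standard hconv hmin.
have -> : (fun i => monomial_xy k (c i)) = (fun i => 'X_[point_exp (c i)])%R.
  by apply: functional_extensionality => l; rewrite monomial_xyE.
set L := fiber_cone_ideal _.
have L0 : L 0%R by exact: fiber_cone_ideal0.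
have LD : forall f g, L f -> L g -> L (f + g)%R by exact: fiber_cone_idealD.
have LM : forall f g, L f -> L (g * f)%R by move=> *; apply: fiber_cone_idealM.
have Lh : forall d f, L f -> L (pihomog mdeg d f).
  by move=> *; apply: fiber_cone_ideal_homog.
have [F hF] := path_resolution L0 LD LM std quadric.
have bettiE i j : graded_betti L i j = if j == shift_of i then #|gens N.+1 i| else 0.
  by rewrite (graded_bettiE L0 LD LM Lh F) hF.
split.
  rewrite bettiE /= -(cards1 (None : gen N.+1)); apply: eq_card => g.
  by rewrite !inE; case: g => [[[]]|].
case=> [//|i] _; split; first by rewrite bettiE eqxx card_gens.
by move=> j /eqP ne; rewrite bettiE (negbTE ne).
Qed.
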